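(* For every $l\ge3$, the singularity $\mathcal S_l$ gives rise to a genuine black hole in $AdS_l$: there exist points of $AdS_l$ from which some light-like geodesics escape the singularity in the future, and there exist points of $AdS_l$ from which all the light-like geodesics intersect the singularity in the future.
   Context: Let $l\ge 3$. Here $SO(p,q)$ denotes the identity component of the special orthogonal group of signature $(p,q)$. Let $G=SO(2,l-1)$ act on $\mathbb R^{2,l-1}$ (two positive and $l-1$ negative directions), let $H=SO(1,l-1)\subset G$ be the stabilizer of a vector of square norm $+1$, with Lie algebras $\mathfrak g,\mathfrak h$, let $B$ be the Killing form of $\mathfrak g$, and let $AdS_l=G/H$, $[g]=gH$, on which $G$ acts by $r\cdot[g]=[rg]$. Let $\sigma$ be the involutive automorphism of $\mathfrak g$ with $+1$-eigenspace $\mathfrak h$ and let $\mathfrak q$ be its $-1$-eigenspace. Let $\theta$ be a Cartan involution commuting with $\sigma$, with $\pm1$-eigenspaces $\mathfrak k,\mathfrak p$. Let $\mathfrak a\subset\mathfrak p$ be maximal abelian with basis $J_1\in\mathfrak h$, $J_2\in\mathfrak q$, normalized so that, with $\mathfrak g_{(\alpha,\beta)}=\{X:[J_1,X]=\alpha X,[J_2,X]=\beta X\}$, the restricted roots are $(\pm1,\pm1)$ and, if $l\ge4$, $(\pm1,0),(0,\pm1)$. Let $\mathfrak n=\mathfrak g_{(1,1)}\oplus\mathfrak g_{(1,-1)}\oplus\mathfrak g_{(1,0)}\oplus\mathfrak g_{(0,1)}$, $\bar{\mathfrak n}=\theta\mathfrak n$, and let $A,N,\bar N$ be the corresponding connected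 subgroups. Choose $X_{++}\in\mathfrak g_{(1,1)}$ with $[\theta X_{++},X_{++}]=4(J_1+J_2)$ and a basis $X^k_{0+}$ ($3\le k\le l-1$) of $\mathfrak g_{(0,1)}$ with $[\theta X^k_{0+},X^k_{0+}]=2J_2$ and $B(X^j_{0+},\theta X^k_{0+})=0$ for $j\ne k$. Put $q_0=\tfrac14(X_{++}-\sigma X_{++}+\theta X_{++}-\sigma\theta X_{++})$, $q_1=J_2$, $q_2=-[J_1,q_0]$, $q_k=\tfrac12(X^k_{0+}-\theta X^k_{0+})$ for $3\le k\le l-1$; these form a basis of $\mathfrak q$. The singularity $\mathcal S_l\subset AdS_l$ is the union of the closed orbits of $AN$ and of $A\bar N$ in $AdS_l$. Up to positive rescaling, the future light-like directions are $E(w)=q_0+\sum_{i=1}^{l-1}w_iq_i$ with $w\in S^{l-2}$ (unit sphere of $\mathbb R^{l-1}$); the corresponding light-like geodesic from $[g]$ is $s\mapsto[ge^{sE(w)}]$, and its future part is $s>0$. It escapes the singularity in the future if $[ge^{sE(w)}]\notin\mathcal S_l$ for all $s>0$, and intersects it in the future otherwise. *)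

(* Defs.v *)
From HB Require Import structures.
From mathcomp Require Import all_boot all_order all_algebra.
From mathcomp Require Import all_classical all_reals all_analysis.

Set Implicit Arguments.
Unset Strict Implicit.
Unset Printing Implicit Defensive.

Import Order.TTheory GRing.Theory Num.Theory.
Import numFieldNormedType.Exports.

Local Open Scope classical_set_scope.
Local Open Scope ring_scope.

Definition expm (R : realType) (n : nat) (X : 'M[R]_n) : 'M[R]_n :=
  lim (series (fun k => k`!%:R^-1 *: X ^+ k) @ \oo).

Definition bracket (R : realType) (n : nat) (X Y : 'M[R]_n) : 'M[R]_n :=
  X *m Y - Y *m X.

(* The Lie algebra of a closed linear group [G]. *)
Definition lie_algebra (R : realType) (n : nat) (G : set 'M[R]_n) :
  set 'M[R]_n := [set X | forall t : R, G (expm (t *: X))].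

(* The connected Lie subgroup whose Lie algebra is [s], i.e. the group
   generated by the exponentials of the elements of the subalgebra [s]
   (inverses come for free since [s] is stable under opposite). *)
Definition connected_subgroup (R : realType) (n : nat) (s : set 'M[R]_n) :
  set 'M[R]_n :=
  [set g | exists2 Xs : seq 'M[R]_n,
     (forall X, X \in Xs -> s X) & g = \prod_(X <- Xs) expm X].

Definition mul_set (R : realType) (n : nat) (A B : set 'M[R]_n) :
  set 'M[R]_n := [set a *m b | a in A & b in B].

Definition is_basis (R : realType) (n : nat) (s : set 'M[R]_n)
  (e : seq 'M[R]_n) : Prop :=
  free e /\ forall X, s X <-> X \in <<e>>%VS.

(* Trace of an endomorphism [f] of the linear subspace [s], computed in an
   arbitrarily chosen basis of [s]. *)
Definition trace_on (R : realType) (n : nat) (s : set 'M[R]_n)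
  (f : 'M[R]_n -> 'M[R]_n) : R :=
  let e := xget [::] [set e | is_basis s e] in
  \sum_(i < size e) coord (in_tuple e) i (f e`_i).

Definition killing (R : realType) (n : nat) (g : set 'M[R]_n)
  (X Y : 'M[R]_n) : R :=
  trace_on g (fun Z => bracket X (bracket Y Z)).

(* Only the restriction of [f] to [g] is meaningful. *)
Definition involutive_automorphism (R : realType) (n : nat)
  (g : set 'M[R]_n) (f : 'M[R]_n -> 'M[R]_n) : Prop :=
  [/\ forall X, g X -> g (f X),
      forall (a : R) X Y, g X -> g Y -> f (a *: X + Y) = a *: f X + f Y,
      forall X Y, g X -> g Y -> f (bracket X Y) = bracket (f X) (f Y)
    & forall X, g X -> f (f X) = X].

Definition eigenspace_on (R : realType) (n : nat) (g : set 'M[R]_n)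
  (f : 'M[R]_n -> 'M[R]_n) (c : R) : set 'M[R]_n :=
  [set X | g X /\ f X = c *: X].

Definition cartan_involution (R : realType) (n : nat) (g : set 'M[R]_n)
  (theta : 'M[R]_n -> 'M[R]_n) : Prop :=
  involutive_automorphism g theta /\
  forall X, g X -> X != 0 -> 0 < - killing g X (theta X).

Definition abelian_in (R : realType) (n : nat) (p : set 'M[R]_n)
  (a : {vspace 'M[R]_n}) : Prop :=
  (forall X, X \in a -> p X) /\
  (forall X Y, X \in a -> Y \in a -> bracket X Y = 0).

Definition maximal_abelian_in (R : realType) (n : nat) (p : set 'M[R]_n)
  (a : {vspace 'M[R]_n}) : Prop :=
  abelian_in p a /\
  forall b : {vspace 'M[R]_n}, abelian_in p b -> (a <= b)%VS -> b = a.

(* A linear form on the span of [J1, J2] is identified with its pair of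
   values [(alpha, beta)] at [J1] and [J2]. *)
Definition root_space (R : realType) (n : nat) (g : set 'M[R]_n)
  (J1 J2 : 'M[R]_n) (alpha beta : R) : set 'M[R]_n :=
  [set X | [/\ g X, bracket J1 X = alpha *: X & bracket J2 X = beta *: X]].

Definition restricted_root (R : realType) (n : nat) (g : set 'M[R]_n)
  (J1 J2 : 'M[R]_n) (alpha beta : R) : Prop :=
  (alpha, beta) <> (0, 0) /\
  exists2 X, root_space g J1 J2 alpha beta X & X != 0.

Definition nilpotent_part (R : realType) (n : nat) (g : set 'M[R]_n)
  (J1 J2 : 'M[R]_n) : set 'M[R]_n :=
  [set X | exists Y1 Y2 Y3 Y4 : 'M[R]_n,
     [/\ root_space g J1 J2 1 1 Y1, root_space g J1 J2 1 (-1) Y2,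
         root_space g J1 J2 1 0 Y3, root_space g J1 J2 0 1 Y4
       & X = Y1 + Y2 + Y3 + Y4]].

Definition sigmx (R : realType) (p q : nat) : 'M[R]_(p + q) :=
  block_mx 1%:M 0 0 (- 1%:M).

Definition sqnorm (R : realType) (p q : nat) (x : 'cV[R]_(p + q)) : R :=
  (x^T *m sigmx R p q *m x) 0 0.

(* [SO] denotes only the identity component. *)
Definition SO (R : realType) (p q : nat) : set 'M[R]_(p + q) :=
  connected_component
    [set g | g^T *m sigmx R p q *m g = sigmx R p q /\ \det g = 1] 1%:M.

Definition stabilizer (R : realType) (n : nat) (G : set 'M[R]_n)
  (v : 'cV[R]_n) : set 'M[R]_n := [set g | G g /\ g *m v = v].

(* [lcls H g] is the coset [gH]; the points of [G/H] are these sets. *)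
Definition lcls (R : realType) (n : nat) (H : set 'M[R]_n) (g : 'M[R]_n) :
  set 'M[R]_n := [set g *m h | h in H].

Definition homogeneous_space (R : realType) (n : nat) (G H : set 'M[R]_n) :
  set (set 'M[R]_n) := [set lcls H g | g in G].

(* Closedness for the quotient topology of [G/H]: the preimage in [G] is
   closed for the topology that [G] inherits from the space of matrices. *)
Definition quotient_closed (R : realType) (n : nat) (G H : set 'M[R]_n)
  (Z : set (set 'M[R]_n)) : Prop :=
  closed ([set g | Z (lcls H g)] : set (subspace G)).

(* The orbit of [gH] under [K], for the action [r . gH = (r g)H]. *)
Definition orbit_of (R : realType) (n : nat) (H K : set 'M[R]_n)
  (g : 'M[R]_n) : set (set 'M[R]_n) := [set lcls H (r *m g) | r in K].

Definition closed_orbits (R : realType) (n : nat) (G H K : set 'M[R]_n) :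
  set (set 'M[R]_n) :=
  [set x | exists g : 'M[R]_n,
     [/\ G g, quotient_closed G H (orbit_of H K g) & orbit_of H K g x]].

Definition singularity (R : realType) (n : nat) (G H : set 'M[R]_n)
  (theta : 'M[R]_n -> 'M[R]_n) (J1 J2 : 'M[R]_n) : set (set 'M[R]_n) :=
  let nn := nilpotent_part (lie_algebra G) J1 J2 in
  let A := connected_subgroup [set X | X \in <<[:: J1; J2]>>%VS] in
  let N := connected_subgroup nn in
  let Nbar := connected_subgroup (theta @` nn) in
  closed_orbits G H (mul_set A N) `|` closed_orbits G H (mul_set A Nbar).

(* [X0p k] is only meaningful for [3 <= k <= l - 1]. *)
Definition qvec (R : realType) (n : nat) (sigma theta : 'M[R]_n -> 'M[R]_n)
  (J1 J2 Xpp : 'M[R]_n) (X0p : nat -> 'M[R]_n) (i : nat) : 'M[R]_n :=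
  let q0 := 4%:R^-1 *:
    (Xpp - sigma Xpp + theta Xpp - sigma (theta Xpp)) in
  match i with
  | 0%N => q0
  | 1%N => J2
  | 2%N => - bracket J1 q0
  | k => 2%:R^-1 *: (X0p k - theta (X0p k))
  end.

(* The direction [q_0 + w_1 q_1 + ... + w_m q_m]; the coordinates of the row
   vector [w] are numbered from [0]. *)
Definition direction (R : realType) (n m : nat) (q : nat -> 'M[R]_n)
  (w : 'rV[R]_m) : 'M[R]_n := q 0%N + \sum_(j < m) w 0 j *: q j.+1.

(* Every representative [g] of [x] is allowed: changing it permutes the
   geodesics from [x] up to positive rescalings of the parameter. *)
Definition lightlike_geodesic (R : realType) (n m : nat) (G H : set 'M[R]_n)
  (q : nat -> 'M[R]_n) (x : set 'M[R]_n) (gamma : R -> set 'M[R]_n) : Prop :=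
  exists (g : 'M[R]_n) (w : 'rV[R]_m),
    [/\ G g, x = lcls H g, \sum_(j < m) w 0 j ^+ 2 = 1
      & gamma = fun s => lcls H (g *m expm (s *: direction q w))].

Definition escapes_future (R : realType) (T : Type) (S : set T)
  (gamma : R -> T) : Prop := forall s : R, 0 < s -> ~ S (gamma s).

Definition intersects_future (R : realType) (T : Type) (S : set T)
  (gamma : R -> T) : Prop := exists2 s : R, 0 < s & S (gamma s).

(* Main.v *)
Require Import Defs.
From HB Require Import structures.
From mathcomp Require Import all_boot all_order all_algebra.
From mathcomp Require Import all_classical all_reals all_analysis.
From mathcomp Require Import ring lra.
Import Order.TTheory GRing.Theory Num.Theory.
Import numFieldNormedType.Exports.
Local Open Scope classical_set_scope.
Local Open Scope ring_scope.

(** The singularity is the zero locus of a quadratic form.  With [<x, y>] the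
    form of signature (2, l-1), [so(2, l-1)] consists of the skew matrices, and
    the elements of [q] are the wedges [U ^ v] with [U] orthogonal to [v].  The
    normalizations of [J_1], [J_2] and of the root vectors provide an
    orthonormal frame [v, t = q_0 v, u = q_1 v, -x = q_2 v, w_k = q_k v] with
    [J_1 = x ^ t], [J_2 = u ^ v], [q_k = (q_k v) ^ v].

    An orbit of [AN] is closed iff [<t + x, .>] vanishes on it, and an orbit of
    [A Nbar] iff [<t - x, .>] does, so [g H] is singular iff
    [<t + x, g v> <t - x, g v> = 0].  Since [E(w)^2 v = 0], light rays are the
    straight lines [g (v + s U)], with [U] null.  The ray [v + s (t + u)] has
    [<t +- x, .> = s], hence escapes.  At [p = 7/8 v - 1/2 t - 1/8 u] one has
    [<t +- x, p> < 0], while every future null [N] tangent at [p] satisfies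
    [<t, N> > 0], so that one of the forms [<t +- x, .>] reaches 0 along
    [p + s N]. *)

Set Implicit Arguments.
Unset Strict Implicit.
Unset Printing Implicit Defensive.

(** * Quadratic form, skew matrices and wedges *)

(** The obstacle is that nothing is given in coordinates. [sigma] and [theta] are arbitrary
    automorphisms subject to a few relations, G is only a connected component, and the exponential
    is only a limit. Hence [sigma] has to be identified from its fixed subalgebra alone. [theta] is
    never computed in full: its values on [J_1], [J_2] and the given root vectors suffice, and the
    signature settles the one sign that the relations leave open ([X0p_wedge]). After that, all
    these data survive only as an orthonormal frame.

    The orbits of A Nbar need no second study. As [theta] sends [J_1] and [J_2] to their opposites,
    A Nbar is the group AN of the opposite pair, that is, of the frame with [u] and [x] negated. The
    orbit analysis is therefore done for an arbitrary such frame and applied twice.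

    Connectedness of G does two jobs: it shows that the orbits with nonzero [<t + x, g v>] are not
    closed, and it makes the time orientation well defined. *)

Lemma mulmx_ext (R : realType) (m n : nat) (X Y : 'M[R]_(m, n)) :
  (forall y : 'cV[R]_n, X *m y = Y *m y) -> X = Y.
Proof.
move=> XY; apply/matrixP => i j; have := XY (delta_mx j 0).
by rewrite -!colE => /matrixP /(_ i 0); rewrite !mxE.
Qed.

Section Entries.
Variables (R : realType) (m n : nat).
Implicit Types A B : 'M[R]_(m, n).

Lemma entryD A B i j : (A + B) i j = A i j + B i j. Proof. by rewrite mxE. Qed.

Lemma entryN A i j : (- A) i j = - A i j. Proof. by rewrite mxE. Qed.

Lemma entryZ a A i j : (a *: A) i j = a * A i j. Proof. by rewrite mxE. Qed.

Lemma entry0 i j : (0 : 'M[R]_(m, n)) i j = 0. Proof. by rewrite mxE. Qed.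

End Entries.

(* Linear identities between vectors are checked entry by entry, without
   expanding the products [X *m x] as [mxE] would do. *)
Ltac vector_entries :=
  apply/matrixP => ? ?; rewrite ?(entryD, entryN, entryZ, entry0).
Ltac vector_ring := vector_entries; ring.

Section QuadraticForm.
Variables (R : realType) (p q : nat).
Notation n := (p + q)%N.
Notation eta := (sigmx R p q).
Implicit Types (x y z : 'cV[R]_n) (X Y Z : 'M[R]_n) (a b c : R).

Definition form x y : R := (x^T *m eta *m y) 0 0.

Lemma tr_sigmx : eta^T = eta.
Proof. by rewrite /sigmx tr_block_mx !trmx0 linearN /= !trmx1. Qed.

Lemma sigmxK : eta *m eta = 1%:M.
Proof.
rewrite /sigmx mulmx_block !mul0mx !mulmx0 !addr0 add0r mul1mx mulNmx mulmxN.
by rewrite opprK mul1mx -scalar_mx_block.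
Qed.

Lemma formC x y : form x y = form y x.
Proof.
rewrite /form -[LHS]mulr1 -[x^T *m eta *m y]trmxK mxE.
by rewrite !trmx_mul trmxK tr_sigmx mulmxA mulr1.
Qed.

Lemma formDl x y z : form (x + y) z = form x z + form y z.
Proof. by rewrite /form linearD /= !mulmxDl mxE. Qed.

Lemma formZl a x z : form (a *: x) z = a * form x z.
Proof. by rewrite /form linearZ /= -!scalemxAl mxE. Qed.

Lemma formDr x y z : form z (x + y) = form z x + form z y.
Proof. by rewrite formC formDl !(formC z). Qed.

Lemma formZr a x z : form z (a *: x) = a * form z x.
Proof. by rewrite formC formZl (formC z). Qed.

Lemma formNl x z : form (- x) z = - form x z.
Proof. by rewrite -scaleN1r formZl mulN1r. Qed.

Lemma formNr x z : form z (- x) = - form z x.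
Proof. by rewrite -scaleN1r formZr mulN1r. Qed.

Lemma form0l z : form 0 z = 0.
Proof. by rewrite -(scale0r 0) formZl mul0r. Qed.

Lemma form0r z : form z 0 = 0.
Proof. by rewrite formC form0l. Qed.

Definition formE := (formDl, formDr, formNl, formNr, formZl, formZr,
  form0l, form0r).

Lemma form_sumr I (r : seq I) (P : pred I) (F : I -> 'cV[R]_n) z :
  form z (\sum_(i <- r | P i) F i) = \sum_(i <- r | P i) form z (F i).
Proof.
by elim/big_rec2: _ => [|i y1 y2 _ <-]; rewrite ?form0r ?formDr.
Qed.

Lemma form_ext x y : (forall z, form z x = form z y) -> x = y.
Proof.
move=> xy; suff: eta *m x = eta *m y.
  by move=> /(congr1 (mulmx eta)); rewrite !mulmxA sigmxK !mul1mx.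
apply/matrixP => i j; have := xy (delta_mx i 0).
by rewrite /form -!mulmxA trmx_delta -!rowE !mxE (ord1 j).
Qed.

Lemma mul_form x y : x^T *m eta *m y = (form x y)%:M.
Proof. by rewrite /form [LHS]mx11_scalar. Qed.

(** This is so(p, q); [lie_algebra_SO] identifies it with the Lie algebra of [SO]. *)
Definition skew : set 'M[R]_n := [set X | X^T *m eta = - (eta *m X)].

Lemma form_skew X y z : skew X -> form (X *m y) z = - form y (X *m z).
Proof.
move=> sX; rewrite /form trmx_mul -(mulmxA _ X^T) sX mulmxN mulNmx mxE.
by rewrite !mulmxA.
Qed.

Lemma form_skew0 X y : skew X -> form y (X *m y) = 0.
Proof. by move=> sX; have := form_skew y y sX; rewrite formC => ?; lra. Qed.

Lemma skewP X : (forall y z, form (X *m y) z = - form y (X *m z)) -> skew X.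
Proof.
move=> sX; rewrite /skew /=; apply: mulmx_ext => z; apply: form_ext => y.
apply: (etrans (y := form (X *m (eta *m y)) z)).
  by rewrite /form !trmx_mul tr_sigmx !mulmxA -(mulmxA y^T).
rewrite sX mulNmx formNr; congr (- _).
by rewrite /form trmx_mul tr_sigmx !mulmxA.
Qed.

Lemma skew_lin a X Y : skew X -> skew Y -> skew (a *: X + Y).
Proof.
rewrite /skew /= => sX sY.
by rewrite !linearD /= !linearZ /= mulmxDl -scalemxAl sX sY.
Qed.

Lemma skew0 : skew 0.
Proof. by rewrite /skew /= linear0 mul0mx mulmx0 oppr0. Qed.

Lemma skewD X Y : skew X -> skew Y -> skew (X + Y).
Proof. by move=> sX sY; rewrite -(scale1r X); exact: skew_lin. Qed.

Lemma skewZ a X : skew X -> skew (a *: X).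
Proof. by move=> sX; rewrite -(addr0 (a *: X)); apply: skew_lin => //; exact: skew0. Qed.

Lemma skewN X : skew X -> skew (- X).
Proof. by rewrite -scaleN1r; exact: skewZ. Qed.

Lemma skew_bracket X Y : skew X -> skew Y -> skew (bracket X Y).
Proof.
move=> sX sY; apply: skewP => y z; rewrite /bracket !mulmxBl !formE -!mulmxA.
by rewrite !form_skew //; ring.
Qed.

(** Under the isomorphism of the exterior square of the space with so(p, q), this is the image of
    the bivector of [x] and [y]. *)
Definition wedge x y : 'M[R]_n := x *m (y^T *m eta) - y *m (x^T *m eta).

Lemma wedgeE x y z : wedge x y *m z = form y z *: x - form x z *: y.
Proof. by rewrite /wedge mulmxBl -!mulmxA !(mulmxA _ eta) !mul_form !mul_mx_scalar. Qed.

Lemma skew_wedge x y : skew (wedge x y).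
Proof.
apply: skewP => z t; rewrite !wedgeE !formE !(formC z); ring.
Qed.

Lemma wedgeDl x y z : wedge (x + y) z = wedge x z + wedge y z.
Proof. by apply: mulmx_ext => t; rewrite [RHS]mulmxDl !wedgeE !formE scalerDr scalerDl opprD addrACA. Qed.

Lemma wedgeZl a x z : wedge (a *: x) z = a *: wedge x z.
Proof. by apply: mulmx_ext => t; rewrite -scalemxAl !wedgeE !formE scalerBr !scalerA mulrC. Qed.

Lemma wedgeC x y : wedge x y = - wedge y x.
Proof. by rewrite /wedge opprB. Qed.

Lemma wedgexx x : wedge x x = 0.
Proof. by rewrite /wedge subrr. Qed.

Lemma wedge0l x : wedge 0 x = 0.
Proof. by rewrite -(scale0r 0) wedgeZl scale0r. Qed.

Lemma wedgeNl x y : wedge (- x) y = - wedge x y.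
Proof. by rewrite -scaleN1r wedgeZl scaleN1r. Qed.

Lemma wedgeDr x y z : wedge z (x + y) = wedge z x + wedge z y.
Proof. by rewrite wedgeC wedgeDl opprD -!(wedgeC z). Qed.

Lemma wedgeNr x y : wedge x (- y) = - wedge x y.
Proof. by rewrite wedgeC wedgeNl -(wedgeC x). Qed.

(** The isomorphism with bivectors is equivariant, [X] acting as a derivation. Consequently the
    weights of [x] and [y] add up in [wedge x y]. *)
Lemma bracket_wedge X x y : skew X ->
  bracket X (wedge x y) = wedge (X *m x) y + wedge x (X *m y).
Proof.
move=> sX; apply: mulmx_ext => z; rewrite /bracket mulmxBl [RHS]mulmxDl -!mulmxA.
rewrite !wedgeE mulmxBr -!scalemxAr !(form_skew _ _ sX) !scaleNr.
vector_ring.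
Qed.

Lemma tr_wedge X x y : skew X -> \tr (X *m wedge x y) = 2 * form y (X *m x).
Proof.
move=> sX; rewrite /wedge mulmxBr linearB /= !mulmxA.
have h (z t : 'cV[R]_n) : \tr (X *m z *m t^T *m eta) = form t (X *m z).
  by rewrite -mulmxA mxtrace_mulC mul_form mxtrace_scalar.
by rewrite !h (formC x) (form_skew _ _ sX); ring.
Qed.

End QuadraticForm.
Arguments formE {R p q}.
Arguments skew0 {R p q}.

(** * Matrix exponential *)

Section MatrixLimits.
Variables (R : realType) (m n : nat).

Lemma cvg_entries (T : Type) (F : set_system T) {FF : Filter F}
  (f : T -> 'M[R]_(m, n)) (M : 'M[R]_(m, n)) :
  (forall i j, (fun x => f x i j) @ F --> M i j) -> f @ F --> M.
Proof.
move=> fM; apply/cvg_ballP => e e0.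
have fMe i j : \forall x \near F, ball (M i j) e (f x i j).
  by have /cvg_ballP := fM i j; apply.
near=> x; split=> // i j; move: i j.
near: x.
have h (i : 'I_m) : \forall x \near F, forall j, ball (M i j) e (f x i j).
  exact: filter_forall.
exact: filter_forall.
Unshelve. all: by end_near. Qed.

Lemma continuous_entries (T : topologicalType) (f : T -> 'M[R]_(m, n)) :
  (forall i j, continuous (fun x => f x i j)) -> continuous f.
Proof. by move=> cf x; apply: cvg_entries => i j; exact: cf. Qed.

End MatrixLimits.

Section MatrixContinuity.
Variables (R : realType).

Lemma cvg_sumr (T : Type) (F : set_system T) {FF : Filter F} (I : Type)
  (r : seq I) (P : pred I) (f : I -> T -> R) (a : I -> R) :
  (forall i, f i @ F --> a i) ->
  (fun x => \sum_(i <- r | P i) f i x) @ F --> \sum_(i <- r | P i) a i.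
Proof.
move=> fa; rewrite (_ : (fun x => _) = \sum_(i <- r | P i) f i); last first.
  by apply/funext => x; rewrite fct_sumE.
elim/big_rec2: _ => [|i y1 y2 _ h]; first exact: cvg_cst.
by apply: cvgD => //; exact: fa.
Qed.

Lemma cvg_prodr (T : Type) (F : set_system T) {FF : Filter F} (I : Type)
  (r : seq I) (P : pred I) (f : I -> T -> R) (a : I -> R) :
  (forall i, f i @ F --> a i) ->
  (fun x => \prod_(i <- r | P i) f i x) @ F --> \prod_(i <- r | P i) a i.
Proof.
move=> fa; elim: r => [|i r IH].
  rewrite big_nil (_ : (fun x => _) = cst 1); first exact: cvg_cst.
  by apply/funext => x; rewrite big_nil.
rewrite big_cons; under eq_fun do rewrite big_cons.
by case: (P i) => //; apply: cvgM => //; exact: fa.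
Qed.

Lemma continuous_mul_entry (p m n q : nat) (A : 'M[R]_(p, m))
  (B : 'M[R]_(n, q)) i j :
  continuous (fun X : 'M[R]_(m, n) => (A *m X *m B) i j).
Proof.
rewrite (_ : (fun X => _) =
  fun X : 'M[R]_(m, n) => \sum_k (\sum_l A i l * X l k) * B k j); last first.
  by apply/funext => Y; rewrite mxE; apply: eq_bigr => k _; rewrite mxE.
move=> X; apply: (@cvg_sumr _ (nbhs X)) => k; apply: cvgM; last exact: cvg_cst.
apply: (@cvg_sumr _ (nbhs X)) => l; apply: cvgM; first exact: cvg_cst.
exact: coord_continuous.
Qed.

Lemma continuous_mull (m n p : nat) (A : 'M[R]_(p, m)) :
  continuous (fun X : 'M[R]_(m, n) => A *m X).
Proof.
apply: continuous_entries => i j.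
rewrite (_ : (fun X => _) = fun X => (A *m X *m 1%:M) i j).
  exact: continuous_mul_entry.
by apply/funext => Y; rewrite mulmx1.
Qed.

End MatrixContinuity.

Section MatrixExponential.
Variables (R : realType) (n : nat).
Implicit Types X Y : 'M[R]_n.

(** Unlike the largest absolute entry, this quantity bounds the entries of [X ^+ k] by its [k]-th
    power without a factor depending on [n]. *)
Let entrysum X : R := \sum_i \sum_j `|X i j|.

Let entrysum_ge0 X : 0 <= entrysum X.
Proof. by apply: sumr_ge0 => i _; apply: sumr_ge0. Qed.

Lemma entry_exp_le X k i j : `|(X ^+ k) i j| <= entrysum X ^+ k.
Proof.
elim: k i j => [|k IH] i j.
  by rewrite expr0 mxE; case: eqP; rewrite ?normr1 ?normr0 ?expr0.
rewrite !exprSr mxE (le_trans (ler_norm_sum _ _ _))//.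
apply: (@le_trans _ _ (\sum_l entrysum X ^+ k * `|X l j|)).
  by apply: ler_sum => l _; rewrite normrM ler_wpM2r.
rewrite -mulr_sumr ler_wpM2l ?exprn_ge0// ler_sum// => l _.
by rewrite (bigD1 j)//= lerDl sumr_ge0.
Qed.

(** Comparison with the real exponential series of [|c|]. The constant [C] makes room for the
    shifted coefficients met in [is_derive_expm]. *)
Lemma cvg_exp_dominated (u : R^nat) (c C : R) :
  (forall k, `|u k| <= C * c ^+ k) -> cvgn (series (fun k => k`!%:R^-1 * u k)).
Proof.
move=> uc; apply: normed_cvg.
have C0 : 0 <= C by have := uc 0%N; rewrite expr0 mulr1; exact: le_trans.
apply: (@series_le_cvg _ _ (fun k => C * exp_coeff `|c| k)) => [k|k|k|].
- exact: normr_ge0.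
- by rewrite mulr_ge0// exp_coeff_ge0.
- rewrite /= /exp_coeff /= normrM ger0_norm ?invr_ge0//.
  rewrite [leRHS]mulrA [leRHS]mulrC ler_wpM2l ?invr_ge0//.
  apply: (le_trans (uc k)); rewrite ler_wpM2l//.
  by rewrite (le_trans (ler_norm _))// normrX.
- exact: (@is_cvg_seriesZ _ _ C (@is_cvg_series_exp_coeff _ `|c|)).
Qed.

Lemma expm_cvg X : series (fun k => k`!%:R^-1 *: X ^+ k) @ \oo --> expm X.
Proof.
rewrite /expm; apply/cvg_ex.
pose u i j : R^nat := series (fun k => k`!%:R^-1 * (X ^+ k) i j).
exists (\matrix_(i, j) limn (u i j)); apply: cvg_entries => i j.
rewrite mxE [X in X @ _ --> _](_ : _ = u i j); last first.
  apply/funext => N; rewrite /u /series /= summxE.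
  by apply: eq_bigr => k _; rewrite mxE.
apply: (@cvg_exp_dominated _ (entrysum X) 1) => k.
by rewrite mul1r; exact: entry_exp_le.
Qed.

(** With rectangular outer factors the exponential can be evaluated on one row or one column, where
    the series may stop or become scalar although the full matrix series does not. *)
Lemma expm_mul_cvg (p q : nat) (A : 'M[R]_(p, n)) X (B : 'M[R]_(n, q)) i j :
  series (fun k => k`!%:R^-1 * (A *m X ^+ k *m B) i j) @ \oo -->
  (A *m expm X *m B) i j.
Proof.
have h := cvg_comp _ _ (@expm_cvg X) (@continuous_mul_entry _ _ _ _ _ A B i j (expm X)).
rewrite [X in X @ _ --> _](_ : _ = (fun X => (A *m X *m B) i j) \o
  series (fun k => k`!%:R^-1 *: X ^+ k)) //.
apply/funext => N; rewrite /series /= mulmx_sumr mulmx_suml summxE.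
by apply: eq_bigr => k _; rewrite -scalemxAr -scalemxAl entryZ.
Qed.

(** Asking for the vanishing only between [A] and [B] covers nilpotent matrices as well as matrices
    that are nilpotent on a single vector or linear form. *)
Lemma expm_mulE (p q : nat) (A : 'M[R]_(p, n)) X (B : 'M[R]_(n, q)) :
  (forall k, A *m X ^+ k.+3 *m B = 0) ->
  A *m expm X *m B = A *m B + A *m X *m B + 2^-1 *: (A *m X *m X *m B).
Proof.
move=> h; apply/matrixP => i j.
apply: (@cvg_unique _ (@norm_hausdorff R R) (series
  (fun k => k`!%:R^-1 * (A *m X ^+ k *m B) i j) @ \oo)).
  exact: expm_mul_cvg.
apply: cvg_near_cst; exists 3%N => // N /= /subnK <-; rewrite addn3.
elim: (N - 3)%N => [|M IH]; last first.
  by rewrite seriesEnat /= big_nat_recr //= h entry0 mulr0 addr0.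
rewrite seriesEnat /= !big_nat_recr //= big_nil add0r !entryD entryZ.
rewrite expr0 mulmx1 expr1 expr2 -mulmxE mulmxA.
by rewrite fact0 !factS fact0 !muln1 !invr1 !mul1r.
Qed.

Lemma expm_eigen X (y : 'cV[R]_n) c : X *m y = c *: y ->
  expm X *m y = expR c *: y.
Proof.
move=> Xy; apply/matrixP => i j.
have := @expm_mul_cvg _ _ 1%:M X y i j; rewrite mul1mx => /(cvg_unique (@norm_hausdorff R R)).
apply=> /=.
have Xk k : X ^+ k *m y = c ^+ k *: y.
  elim: k => [|k IH]; first by rewrite !expr0 mul1mx scale1r.
  by rewrite exprSr -mulmxA Xy -scalemxAr IH scalerA exprS.
rewrite [X in X @ _ --> _](_ : _ = fun N => series (exp_coeff c) N * y i j); last first.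
  apply/funext => N; rewrite /series /= mulr_suml; apply: eq_bigr => k _.
  by rewrite mul1mx Xk entryZ /exp_coeff /=; ring.
rewrite mxE; apply: cvgM; last exact: cvg_cst.
exact: is_cvg_series_exp_coeff.
Qed.

Lemma expm_eigenl X (y : 'rV[R]_n) c : y *m X = c *: y ->
  y *m expm X = expR c *: y.
Proof.
move=> Xy; apply/matrixP => i j.
have := @expm_mul_cvg _ _ y X 1%:M i j; rewrite mulmx1 => /(cvg_unique (@norm_hausdorff R R)).
apply=> /=.
have Xk k : y *m X ^+ k = c ^+ k *: y.
  elim: k => [|k IH]; first by rewrite !expr0 mulmx1 scale1r.
  by rewrite exprS mulmxA Xy -scalemxAl IH scalerA exprS.
rewrite [X in X @ _ --> _](_ : _ = fun N => series (exp_coeff c) N * y i j); last first.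
  apply/funext => N; rewrite /series /= mulr_suml; apply: eq_bigr => k _.
  by rewrite mulmx1 Xk entryZ /exp_coeff /=; ring.
rewrite mxE; apply: cvgM; last exact: cvg_cst.
exact: is_cvg_series_exp_coeff.
Qed.

Lemma expm0 : expm (0 : 'M[R]_n) = 1%:M.
Proof.
have := @expm_mulE _ _ 1%:M 0 1%:M; rewrite !mulmx1 !mulmx0 !mul1mx.
by rewrite scaler0 !addr0; apply=> k; rewrite expr0n /= mulmx0 mul0mx.
Qed.

Lemma mx_exprZ (t : R) X k : (t *: X) ^+ k = t ^+ k *: X ^+ k.
Proof.
elim: k => [|k IH]; first by rewrite !expr0 scale1r.
by rewrite !exprS IH -!mulmxE -scalemxAl -scalemxAr scalerA.
Qed.

(** Each entry is a power series in [t] with coefficients [(X ^+ k) i j / k!]. Termwise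
    differentiation shifts [k] by one in the numerator, which amounts to multiplying by [X]. *)
Lemma is_derive_expm X i j (t : R) :
  is_derive t 1 (fun t => expm (t *: X) i j) ((X *m expm (t *: X)) i j).
Proof.
pose c (u : R^nat) k := k`!%:R^-1 * u k.
pose x k := (X ^+ k) i j.
have diffs u : pseries_diffs (c u) = c (fun k => u k.+1).
  apply/funext => k; rewrite /pseries_diffs /c factS natrM invfM !mulrA.
  by rewrite mulfV ?mul1r// pnatr_eq0.
(* Used for [a] = 0, 1, 2: differentiating at [t] requires the series and its first two formal
   derivatives to converge at [|t| + 1]. *)
have cvgc (a : nat) s : cvgn (pseries (c (fun k => x (k + a)%N)) s).
  rewrite /pseries /c [X in cvgn X](_ : _ =
    series (fun k => k`!%:R^-1 * (x (k + a)%N * s ^+ k))); last first.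
    by apply/funext => N; apply: eq_bigr => k _; rewrite mulrA.
  apply: (@cvg_exp_dominated _ (entrysum X * `|s|) (entrysum X ^+ a)) => k.
  rewrite normrM normrX exprMn mulrA ler_wpM2r ?exprn_ge0//.
  by rewrite -exprD addnC; exact: entry_exp_le.
have XtE : (X *m expm (t *: X)) i j = limn (pseries (pseries_diffs (c x)) t).
  apply/esym/cvg_lim => //; rewrite diffs.
  rewrite (_ : pseries _ t = series (fun k =>
    k`!%:R^-1 * (X *m (t *: X) ^+ k *m 1%:M) i j)); last first.
    apply/funext => N; apply: eq_bigr => k _; rewrite /c /x mulmx1 mx_exprZ.
    by rewrite -scalemxAr entryZ mulmxE -exprS /= -mulrA (mulrC (t ^+ k)).
  by have := @expm_mul_cvg _ _ X (t *: X) 1%:M i j; rewrite mulmx1.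
have tE : (fun t => expm (t *: X) i j) = (fun t => limn (pseries (c x) t)).
  apply/funext => s; apply/esym/cvg_lim => //.
  rewrite (_ : pseries _ s = series (fun k =>
    k`!%:R^-1 * (1%:M *m (s *: X) ^+ k *m 1%:M) i j)); last first.
    apply/funext => N; apply: eq_bigr => k _; rewrite /c mulmx1 mul1mx mx_exprZ.
    by rewrite entryZ /= -mulrA (mulrC (s ^+ k)).
  by have := @expm_mul_cvg _ _ 1%:M (s *: X) 1%:M i j; rewrite mulmx1 mul1mx.
rewrite XtE tE; apply: (@pseries_snd_diffs _ _ (`|t| + 1)).
- by have := cvgc 0%N (`|t| + 1); under eq_fun do rewrite addn0.
- rewrite diffs.
  by have := cvgc 1%N (`|t| + 1); under eq_fun do rewrite addn1.
- rewrite !diffs.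
  by have := cvgc 2%N (`|t| + 1); under eq_fun do rewrite addn2.
by rewrite [ltRHS]ger0_norm// addrC -subr_gt0 addrK.
Qed.

Lemma continuous_expm X : continuous (fun t : R => expm (t *: X)).
Proof.
apply: continuous_entries => i j t.
apply/differentiable_continuous/derivable1_diffP.
by have [] := is_derive_expm X i j t.
Qed.

End MatrixExponential.

(** * One-parameter groups of isometries *)

Section FormDerivative.
Variables (R : realType) (p q : nat).
Notation n := (p + q)%N.
Implicit Types (X : 'M[R]_n) (x y : 'cV[R]_n).

Definition sgn_row : 'rV[R]_n := row_mx (const_mx 1) (const_mx (-1)).

Lemma sigmx_diag : sigmx R p q = diag_mx sgn_row.
Proof.
rewrite /sgn_row diag_mx_row /sigmx; congr block_mx.
  by apply/matrixP => i j; rewrite !mxE.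
by apply/matrixP => i j; rewrite !mxE; case: eqP; rewrite ?mulr0n ?mulr1n ?oppr0.
Qed.

Lemma form_sum x y : form x y = \sum_i sgn_row 0 i * (x i 0 * y i 0).
Proof.
rewrite /form sigmx_diag mul_mx_diag mxE; apply: eq_bigr => i _.
by rewrite !mxE; ring.
Qed.

Lemma is_derive_form (u w : R -> 'cV[R]_n) (u' w' : 'cV[R]_n) (t : R) :
  (forall i, is_derive t 1 (fun s => u s i 0) (u' i 0)) ->
  (forall i, is_derive t 1 (fun s => w s i 0) (w' i 0)) ->
  is_derive t 1 (fun s => form (u s) (w s)) (form u' (w t) + form (u t) w').
Proof.
move=> hu hw.
rewrite (_ : (fun s => _) = \sum_i
  (sgn_row 0 i \*: ((fun s => u s i 0) * (fun s => w s i 0)))); last first.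
  by apply/funext => s; rewrite form_sum fct_sumE.
apply: is_derive_eq; rewrite !form_sum -big_split /=; apply: eq_bigr => i _.
by rewrite /GRing.scale /=; ring.
Qed.

Lemma is_derive_expm_mul X y i (t : R) :
  is_derive t 1 (fun s => (expm (s *: X) *m y) i 0)
    ((X *m (expm (t *: X) *m y)) i 0).
Proof.
rewrite (_ : (fun s => _) = \sum_j
  (y j 0 \*: (fun s => expm (s *: X) i j))); last first.
  apply/funext => s; rewrite mxE fct_sumE; apply: eq_bigr => j _.
  by rewrite /= mulrC.
have hE j := is_derive_expm X i j t; apply: is_derive_eq.
by rewrite mulmxA mxE; apply: eq_bigr => j _; rewrite mulrC.
Qed.

(** Along [t], the derivative of the form is [<X y1, y2> + <y1, X y2>] at the moving vectors, which
    is zero for skew [X]. *)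
Lemma form_expm X x y : skew X ->
  form (expm X *m x) (expm X *m y) = form x y.
Proof.
move=> sX; pose F t := form (expm (t *: X) *m x) (expm (t *: X) *m y).
have : F 1 = F 0.
  apply: is_derive_0_is_cst => t; apply: is_derive_eq.
    by apply: is_derive_form => i; exact: is_derive_expm_mul.
  by rewrite /= form_skew// addNr.
by rewrite /F scale1r scale0r expm0 !mul1mx.
Qed.

(** Conversely, differentiate the constant function at [t = 0]. *)
Lemma skew_of_form_expm X :
  (forall (t : R) x y,
    form (expm (t *: X) *m x) (expm (t *: X) *m y) = form x y) ->
  skew X.
Proof.
move=> h; apply: skewP => y z.
have h1 : is_derive (0 : R) 1
    (fun t => form (expm (t *: X) *m y) (expm (t *: X) *m z))
    (form (X *m y) z + form y (X *m z)).
  apply: is_derive_eq; first by apply: is_derive_form => i;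
    exact: is_derive_expm_mul.
  by rewrite /= scale0r expm0 !mul1mx.
have h2 : is_derive (0 : R) 1
    (fun t => form (expm (t *: X) *m y) (expm (t *: X) *m z)) 0.
  rewrite (_ : (fun t => _) = cst (form y z)); first exact: is_derive_cst.
  by apply/funext => t; rewrite h.
have [_ e1] := h1; have [_ e2] := h2.
by apply/eqP; rewrite -addr_eq0 -e1 e2.
Qed.

End FormDerivative.

(** * Connectedness and constancy of sign *)

Section ConnectedSets.
Variables (R : realType).

Lemma connected_range (T : topologicalType) (f : R -> T) :
  continuous f -> connected (range f).
Proof.
move=> cf; apply: connected_continuous_connected.
  by apply/connected_intervalP => x y _ _ z _.
exact: continuous_subspaceT.
Qed.

(** The intermediate value theorem. It serves for the determinant along a one-parameter group and
    for the time orientation on G. *)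
Lemma connected_range_gt0 (T : topologicalType) (A : set T) (f : T -> R) :
  connected A -> (forall x, continuous_at x f) ->
  (forall x, A x -> f x != 0) ->
  forall x y, A x -> A y -> 0 < f x -> 0 < f y.
Proof.
move=> cA cf f0 x y Ax Ay fx; rewrite ltNge; apply/negP => fy.
have cfA : connected (f @` A).
  by apply: connected_continuous_connected => //; exact: continuous_subspaceT.
have [z Az fz] : (f @` A) 0.
  apply: (proj1 (connected_intervalP _) cfA (f y) (f x)); [by exists y|by exists x|].
  by rewrite fy ltW.
by have := f0 z Az; rewrite fz eqxx.
Qed.

Lemma continuous_det (n : nat) : continuous (fun X : 'M[R]_n => \det X).
Proof.
move=> X; apply: (@cvg_sumr _ _ (nbhs X)) => s; apply: cvgM.
  exact: cvg_cst.
by apply: (@cvg_prodr _ _ (nbhs X)) => i; exact: coord_continuous.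
Qed.

End ConnectedSets.

(** * The identity component and its Lie algebra *)

Section IdentityComponent.
Variables (R : realType) (p q : nat).
Notation n := (p + q)%N.
Notation eta := (sigmx R p q).
Notation G := (@SO R p q).
Implicit Types (X g h : 'M[R]_n) (x y v : 'cV[R]_n).

Let O : set 'M[R]_n := [set g | g^T *m eta *m g = eta /\ \det g = 1].

Lemma mul_isometry g x y : g^T *m eta *m g = eta ->
  form (g *m x) (g *m y) = form x y.
Proof.
by move=> h; rewrite /form trmx_mul -[in RHS]h !mulmxA.
Qed.

Lemma isometry_mul g : (forall x y, form (g *m x) (g *m y) = form x y) ->
  g^T *m eta *m g = eta.
Proof.
move=> h; apply: mulmx_ext => y.
suff e : eta *m (g^T *m eta *m g *m y) = y.
  by rewrite -[in RHS]e [RHS]mulmxA sigmxK mul1mx.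
apply: form_ext => z; rewrite -[RHS]h /form trmx_mul.
by rewrite -!mulmxA (mulmxA eta eta) sigmxK mul1mx !mulmxA.
Qed.

Let OM g h : O g -> O h -> O (g *m h).
Proof.
move=> [g1 g2] [h1 h2]; split; last by rewrite det_mulmx g2 h2 mulr1.
by apply: isometry_mul => x y; rewrite -!mulmxA !mul_isometry.
Qed.

Let O1 : O 1%:M.
Proof. by split; rewrite ?det1// trmx1 mul1mx mulmx1. Qed.

Let inv g := eta *m g^T *m eta.

Let mulVO g : O g -> inv g *m g = 1%:M.
Proof. by move=> [h _]; rewrite /inv -!mulmxA (mulmxA _ eta) h sigmxK. Qed.

Let mulOV g : O g -> g *m inv g = 1%:M.
Proof. by move=> /mulVO /mulmx1C. Qed.

Let OV g : O g -> O (inv g).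
Proof.
move=> Og; split; last first.
  have := mulVO Og => /(congr1 determinant).
  by rewrite det_mulmx (proj2 Og) mulr1 det1.
apply: isometry_mul => x y; have [h _] := Og.
by rewrite -(mul_isometry _ _ h) 2!(mulmxA g (inv g)) mulOV// !mul1mx.
Qed.

Lemma SO_sub g : G g -> g^T *m eta *m g = eta /\ \det g = 1.
Proof. exact: connected_component_sub. Qed.

Lemma SO_form g x y : G g -> form (g *m x) (g *m y) = form x y.
Proof. by move=> /SO_sub[h _]; exact: mul_isometry. Qed.

Lemma SO_connected : connected G.
Proof. exact: component_connected. Qed.

Lemma SO1 : G 1%:M.
Proof. by apply: connected_component_refl; exact: O1. Qed.

(** The translate [gG] is connected and meets [G] at [g h], so its union with [G] is a connected
    part of [O] containing 1, hence lies in [G]. Taking [h = 1] gives products, and translating by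
    [inv g] with [h = g] gives inverses. *)
Let SO_translate g h : O g -> G h -> G (g *m h) ->
  forall k, G k -> G (g *m k).
Proof.
move=> Og Gh Ggh k Gk; pose gG := [set g *m k | k in G].
have gGc : connected gG.
  apply: connected_continuous_connected SO_connected _.
  by apply: continuous_subspaceT; exact: continuous_mull.
apply: (@connected_component_max _ O (G `|` gG)).
- by left; exact: SO1.
- move=> _ [/SO_sub//|[l Gl <-]]; apply: OM => //; exact: SO_sub.
- apply: connectedU => //; last exact: SO_connected.
  by exists (g *m h); split => //; exists h.
- by right; exists k.
Qed.

Lemma SO_mul g h : G g -> G h -> G (g *m h).
Proof.
move=> Gg Gh; apply: (@SO_translate g 1%:M) => //.
- exact: SO_sub.
- exact: SO1.
- by rewrite mulmx1.
Qed.

Lemma SO_inv g : G g -> exists2 h, G h & h *m g = 1%:M /\ g *m h = 1%:M.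
Proof.
move=> Gg; have Og := SO_sub Gg; exists (inv g); last first.
  by rewrite mulVO ?mulOV.
rewrite -[inv g]mulmx1; apply: (@SO_translate (inv g) g) => //.
- exact: OV.
- by rewrite mulVO//; exact: SO1.
- exact: SO1.
Qed.

(** The path of the [expm (t *: X)] joins 1 to [expm X] inside [O]: these are isometries, so their
    determinant squares to 1, and it stays positive by connectedness. *)
Lemma SO_expm X : skew X -> G (expm X).
Proof.
move=> sX; have iso t : (expm (t *: X))^T *m eta *m expm (t *: X) = eta.
  by apply: isometry_mul => x y; apply: form_expm; exact: skewZ.
have d2 t : \det (expm (t *: X)) * \det (expm (t *: X)) = 1.
  have /(congr1 determinant) := iso t; rewrite !det_mulmx det_tr.
  set d := \det (expm _) => dE; have : \det eta * \det eta = 1.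
    by rewrite -det_mulmx sigmxK det1.
  by move=> h; rewrite -h -{1}dE; ring: h.
have dpos t : 0 < \det (expm (t *: X)).
  apply: (@connected_range_gt0 R _ (range (fun t : R => expm (t *: X)))
    (fun X => \det X) _ _ _ (expm (0 *: X))).
  - by apply: connected_range; exact: continuous_expm.
  - exact: continuous_det.
  - move=> _ [s _ <-]; apply: contra_eq_neq (d2 s) => ->.
    by rewrite mul0r eq_sym oner_eq0.
  - by exists 0.
  - by exists t.
  - by rewrite scale0r expm0 det1.
apply: (@connected_component_max _ O (range (fun t : R => expm (t *: X)))).
- by exists 0 => //; rewrite scale0r expm0.
- move=> _ [t _ <-]; split; first exact: iso.
  have := d2 t; have := dpos t; set d := \det _ => d0 dd.
  have /eqP : (d - 1) * (d + 1) = 0 by ring: dd.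
  by rewrite mulf_eq0 => /orP[|] /eqP ?; lra.
- by apply: connected_range; exact: continuous_expm.
- by exists 1 => //; rewrite scale1r.
Qed.

Lemma lie_algebra_SO : lie_algebra G = @skew R p q.
Proof.
apply/seteqP; split=> X h.
  by apply: skew_of_form_expm => t x y; exact: SO_form (h t).
by move=> t; apply: SO_expm; exact: skewZ.
Qed.

Lemma lie_algebra_stabilizer v :
  lie_algebra (stabilizer G v) = [set X | skew X /\ X *m v = 0].
Proof.
apply/seteqP; split=> X /=.
  move=> h; split.
    by rewrite -lie_algebra_SO => t; have [] := h t.
  apply/matrixP => i j; rewrite (ord1 j) [RHS]mxE.
  have := is_derive_expm_mul X v i 0; rewrite scale0r expm0 mul1mx.
  rewrite (_ : (fun s => _) = cst (v i 0)); last first.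
    by apply/funext => s; have [_ ->] := h s.
  by case=> _ <-; exact: derive_val.
move=> [sX Xv] t; split; first by apply: SO_expm; exact: skewZ.
rewrite (@expm_eigen _ _ _ _ 0) ?expR0 ?scale1r// scale0r.
by rewrite -scalemxAl Xv scaler0.
Qed.

(** This identifies G/H with the orbit of [v], so that points of AdS are handled as vectors [g v] of
    norm 1. *)
Lemma lclsP v g h : G g -> G h ->
  lcls (stabilizer G v) g = lcls (stabilizer G v) h <-> g *m v = h *m v.
Proof.
move=> Gg Gh; split=> [e|e].
  have : lcls (stabilizer G v) h g.
    by rewrite -e; exists 1%:M; rewrite ?mulmx1//; split;
      [exact: SO1|rewrite mul1mx].
  by move=> [k [_ kv] <-]; rewrite -mulmxA kv.
have sub g1 g2 : G g1 -> G g2 -> g1 *m v = g2 *m v ->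
    lcls (stabilizer G v) g1 `<=` lcls (stabilizer G v) g2.
  move=> G1 G2 e12 _ [k [Gk kv] <-]; have [l Gl [lg gl]] := SO_inv G2.
  exists (l *m (g1 *m k)); last by rewrite !mulmxA gl mul1mx.
  split; first by do 2! apply: SO_mul => //.
  by rewrite -!mulmxA kv e12 mulmxA lg mul1mx.
by apply/seteqP; split; apply: sub.
Qed.

End IdentityComponent.

(** * Killing form *)

Section KillingForm.
Variables (R : realType).

(* Composing [f] with a projection onto [s] makes its trace computable on
   elementary matrices, whatever the basis chosen in [trace_on]. *)
Lemma trace_on_projection (n : nat) (s : set 'M[R]_n)
  (f pi : {linear 'M[R]_n -> 'M[R]_n}) :
  (exists e, is_basis s e) ->
  (forall Z, s (pi Z)) -> (forall Z, s Z -> pi Z = Z) ->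
  (forall Z, s Z -> s (f Z)) ->
  trace_on s f = \sum_i \sum_j (f (pi (delta_mx i j))) i j.
Proof.
move=> [e0 e0P] pis pid fs; rewrite /trace_on.
set e := xget _ _; have [_ eE] : is_basis s e by apply: (xgetPex _ (ex_intro _ e0 e0P)).
pose c k Z := coord (in_tuple e) k (f (pi Z)).
have fE Z : f (pi Z) = \sum_(k < size e) c k Z *: e`_k.
  by apply: coord_span; apply/eE; apply: fs.
transitivity (\sum_(k < size e) \sum_i \sum_j e`_k i j * c k (delta_mx i j)).
  apply: eq_bigr => k _; rewrite -[in LHS](pid e`_k); last first.
    by apply/eE; rewrite memv_span ?mem_nth.
  rewrite {1}[e`_k]matrix_sum_delta !linear_sum /=; apply: eq_bigr => i _.
  by rewrite !linear_sum /=; apply: eq_bigr => j _; rewrite !linearZ.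
rewrite exchange_big /=; apply: eq_bigr => i _.
rewrite exchange_big /=; apply: eq_bigr => j _.
by rewrite fE summxE; apply: eq_bigr => k _; rewrite entryZ mulrC.
Qed.

(** The left-hand side is the trace of the endomorphism sending [Z] to [A Z B]; in the next lemma it
    is the trace of the one sending [Z] to [A Z^T B]. *)
Lemma sum_mul_delta (n : nat) (A B : 'M[R]_n) :
  \sum_i \sum_j (A *m delta_mx i j *m B) i j = \tr A * \tr B.
Proof.
rewrite /mxtrace mulr_suml; apply: eq_bigr => i _; rewrite mulr_sumr.
apply: eq_bigr => j _; rewrite mxE (bigD1 j)//= big1 ?addr0 => [|k kj].
  rewrite mxE (bigD1 i)//= big1 ?addr0 => [|k ki].
    by rewrite mxE !eqxx mulr1.
  by rewrite mxE (negbTE ki) mulr0.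
rewrite mxE big1 ?mul0r// => l _.
by rewrite mxE (negbTE kj) andbF mulr0.
Qed.

Lemma sum_mul_tr_delta (n : nat) (A B : 'M[R]_n) :
  \sum_i \sum_j (A *m (delta_mx i j)^T *m B) i j = \tr (A *m B^T).
Proof.
rewrite /mxtrace; apply: eq_bigr => i _; rewrite mxE.
apply: eq_bigr => j _; rewrite trmx_delta !mxE (bigD1 i)//= big1 ?addr0 => [|k kj].
  rewrite mxE (bigD1 j)//= big1 ?addr0 => [|k ki].
    by rewrite mxE !eqxx mulr1.
  by rewrite mxE (negbTE ki) mulr0.
rewrite mxE big1 ?mul0r// => l _.
by rewrite mxE (negbTE kj) andbF mulr0.
Qed.

Variables (p q : nat).
Notation n := (p + q)%N.
Notation eta := (sigmx R p q).
Implicit Types X Y Z : 'M[R]_n.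

(** The map sending [Z] to [- eta Z^T eta] is an involution with fixed space [skew]; averaging it
    with the identity gives the projection needed by [trace_on_projection]. *)
Definition skew_proj Z : 'M[R]_n := 2^-1 *: (Z - eta *m Z^T *m eta).

Lemma skew_proj_is_linear : linear skew_proj.
Proof.
move=> a Y Z; rewrite /skew_proj linearP /= mulmxDr mulmxDl -scalemxAr -scalemxAl.
by vector_ring.
Qed.

HB.instance Definition _ :=
  GRing.isLinear.Build R 'M[R]_n 'M[R]_n _ skew_proj skew_proj_is_linear.

Lemma skewE X : skew X -> eta *m X^T *m eta = - X.
Proof. by move=> sX; rewrite -mulmxA sX mulmxN mulmxA sigmxK mul1mx. Qed.

Lemma skew_proj_skew Z : skew (skew_proj Z).
Proof.
apply: skewZ; rewrite /skew /= linearB /= !trmx_mul trmxK tr_sigmx.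
rewrite mulmxBl mulmxBr -!mulmxA sigmxK mulmx1 !(mulmxA eta eta) sigmxK mul1mx.
by rewrite opprB.
Qed.

Lemma skew_proj_id Z : skew Z -> skew_proj Z = Z.
Proof. by move=> sZ; rewrite /skew_proj skewE//; vector_entries; field. Qed.

Lemma skew_has_basis : exists e, is_basis (@skew R p q) e.
Proof.
pose U := limg (linfun skew_proj); exists (vbasis U); split.
  exact: basis_free (vbasisP U).
move=> X; rewrite (span_basis (vbasisP U)); split=> [sX|/memv_imgP[Y _ ->]].
  by apply/memv_imgP; exists X; rewrite ?memvf// lfunE /= skew_proj_id.
by rewrite lfunE /=; exact: skew_proj_skew.
Qed.

Lemma tr_skew X : skew X -> \tr X = 0.
Proof.
move=> /skewE /(congr1 (@mxtrace R n)); rewrite mxtrace_mulC mulmxA sigmxK.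
by rewrite mul1mx mxtrace_tr linearN /= => h; lra.
Qed.

(** On projected matrices the endomorphism has eight terms. The four without transpose give
    [2 n tr (X Y)], up to products of traces that vanish; the four with transpose give
    [- 4 tr (X Y)]; the projection halves the total. *)
Lemma killing_skew X Y : skew X -> skew Y ->
  killing (@skew R p q) X Y = (n%:R - 2) * \tr (X *m Y).
Proof.
move=> sX sY; pose f Z := bracket X (bracket Y Z).
have f_lin : linear f.
  move=> a Z T; rewrite /f /bracket !(mulmxDr, mulmxDl, mulmxN, mulNmx).
  by rewrite -!(scalemxAr, scalemxAl); vector_ring.
pose fL := HB.pack_for {linear 'M[R]_n -> 'M[R]_n} f
  (GRing.isLinear.Build R 'M[R]_n 'M[R]_n _ f f_lin).
rewrite /killing (_ : (fun Z => _) = fL) // (@trace_on_projection _ _ fL skew_proj).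
- pose d := @delta_mx R n n.
  have fd i j : f (skew_proj (d i j)) = 2^-1 *: (
      (X *m Y *m d i j *m 1%:M - X *m d i j *m Y
       - Y *m d i j *m X + 1%:M *m d i j *m (Y *m X))
    - (X *m Y *m eta *m (d i j)^T *m eta
       - X *m eta *m (d i j)^T *m (eta *m Y)
       - Y *m eta *m (d i j)^T *m (eta *m X)
       + eta *m (d i j)^T *m (eta *m Y *m X))).
    rewrite /f /bracket /skew_proj.
    rewrite mulmx1 mul1mx !(mulmxDr, mulmxDl, mulmxN, mulNmx).
    rewrite -!(scalemxAr, scalemxAl) ?(mulmxDr, mulmxDl, mulmxN, mulNmx).
    by rewrite !mulmxA; vector_ring.
  rewrite /= -/f.
  under eq_bigr => i _ do under eq_bigr => j _ do
    rewrite fd !(entryZ, entryD, entryN).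
  under eq_bigr => i _ do rewrite -mulr_sumr !(big_split, sumrN) /=.
  rewrite -mulr_sumr !(big_split, sumrN) /=.
  rewrite !sum_mul_delta !sum_mul_tr_delta (tr_skew sX) (tr_skew sY).
  have tr2 A B : skew B -> \tr (A *m eta *m (eta *m B)^T) = - \tr (A *m B).
    move=> sB; rewrite trmx_mul tr_sigmx -!mulmxA (mulmxA eta B^T) skewE//.
    by rewrite mulmxN linearN.
  have tr4 : \tr (eta *m (eta *m Y *m X)^T) = \tr (X *m Y).
    rewrite -mulmxA trmx_mul tr_sigmx mxtrace_mulC -mulmxA sigmxK mulmx1.
    by rewrite mxtrace_tr mxtrace_mulC.
  have tr1 : \tr (X *m Y *m eta *m eta^T) = \tr (X *m Y).
    by rewrite tr_sigmx -mulmxA sigmxK mulmx1.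
  by rewrite tr1 !tr2// tr4 mxtrace1 (mxtrace_mulC Y X); field.
- exact: skew_has_basis.
- exact: skew_proj_skew.
- exact: skew_proj_id.
- by move=> Z sZ; do 2! apply: skew_bracket => //.
Qed.

End KillingForm.

(** * The symmetric pair *)

Section SymmetricPair.
Variables (R : realType) (p q : nat).
Notation n := (p + q)%N.
Notation skew := (@skew R p q).
Implicit Types (X Y Z : 'M[R]_n) (x y z w : 'cV[R]_n).

Section Automorphism.
Variable f : 'M[R]_n -> 'M[R]_n.
Hypothesis fA : involutive_automorphism skew f.

Lemma autN X : skew X -> f (- X) = - f X.
Proof.
move=> sX; have [_ lin _ _] := fA; have f0 : f 0 = 0.
  by have := lin (-1) 0 0 skew0 skew0; rewrite scaler0 addr0 scaleN1r addNr.
by have := lin (-1) X 0 sX skew0; rewrite !scaleN1r addr0 f0 addr0.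
Qed.

Lemma autD X Y : skew X -> skew Y -> f (X + Y) = f X + f Y.
Proof. by move=> sX sY; have [_ lin _ _] := fA; rewrite -[X in LHS]scale1r lin// scale1r. Qed.

Lemma autZ a X : skew X -> f (a *: X) = a *: f X.
Proof.
move=> sX; have [_ lin _ _] := fA; have f0 : f 0 = 0.
  by have := lin (-1) 0 0 skew0 skew0; rewrite scaler0 addr0 scaleN1r addNr.
by rewrite -[a *: X in LHS]addr0 lin ?f0 ?addr0//; exact: skew0.
Qed.

End Automorphism.

Variables (v : 'cV[R]_n) (sigma : 'M[R]_n -> 'M[R]_n).
Hypothesis v1 : form v v = 1.
Hypothesis sA : involutive_automorphism skew sigma.
Hypothesis sH : eigenspace_on skew sigma 1 = [set X | skew X /\ X *m v = 0].

Lemma wedge_fix y : form y v = 0 -> wedge y v *m v = y.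
Proof. by move=> yv; rewrite wedgeE v1 yv scale1r scale0r subr0. Qed.

Lemma sigma_fixed X : skew X -> X *m v = 0 -> sigma X = X.
Proof.
move=> sX Xv; have : eigenspace_on skew sigma 1 X by rewrite sH.
by case=> _ ->; rewrite scale1r.
Qed.

Lemma form_ext_perp x y : (forall z, form v z = 0 -> form z x = form z y) ->
  form v x = form v y -> x = y.
Proof.
move=> h hv; apply: form_ext => z.
have := h (z - form v z *: v); rewrite !formE v1 mulr1 subrr => /(_ erefl).
by rewrite hv => /addIr.
Qed.

(* [sigma M = - M + 2 D M] on the complement [M_U = wedge U v] of [h], with
   [D M] in [h].  Comparing [sigma [M_U, M_W] = [M_U, M_W]] with
   [[sigma M_U, sigma M_W]] gives [D_U W = D_W U]; as each [D_U] is skew, the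
   trilinear form [form (D_U W) T] is symmetric in its first two arguments and
   antisymmetric in the last two, hence zero. *)
Lemma sigma_wedge y : form v y = 0 -> sigma (wedge y v) = - wedge y v.
Proof.
pose M y := wedge y v; pose D y := 2^-1 *: (M y + sigma (M y)).
have [sg _ brk inv] := sA.
have sM z : skew (M z) by exact: skew_wedge.
have sD z : skew (D z) by apply: skewZ; apply: skewD => //; exact: sg.
have Dv z : D z *m v = 0.
  have : eigenspace_on skew sigma 1 (D z).
    split; first exact: sD.
    have sS : skew (sigma (M z)) by exact: sg.
    rewrite scale1r /D (autZ sA); last exact: skewD.
    by rewrite (autD sA)// inv// addrC.
  by rewrite sH => -[].
have sigmaM z : sigma (M z) = 2 *: D z - M z.
  by rewrite /D; vector_entries; field.
have Mv z : form v z = 0 -> M z *m v = z by rewrite formC; exact: wedge_fix.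
have MM y1 y2 : form v y1 = 0 -> form v y2 = 0 -> M y1 *m y2 = M y2 *m y1.
  by move=> h1 h2; rewrite /M !wedgeE h1 h2 !scale0r formC.
rewrite -/(M y); clearbody D M.
have Dsym y1 y2 : form v y1 = 0 -> form v y2 = 0 -> D y1 *m y2 = D y2 *m y1.
  move=> h1 h2; have : sigma (bracket (M y1) (M y2)) *m v = 0.
    rewrite sigma_fixed; last first.
    - by rewrite /bracket mulmxBl -!mulmxA !Mv// MM// subrr.
    - exact: skew_bracket.
    by rewrite /bracket mulmxBl -!mulmxA !Mv// MM// subrr.
  rewrite brk// /bracket !sigmaM mulmxBl -!mulmxA !(mulmxBl, =^~ scalemxAl) !Dv.
  rewrite !Mv// !scaler0 !sub0r !mulmxN (MM y1)// => h.
  apply/matrixP => i j; have /matrixP/(_ i j) := h.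
  rewrite !(entryD, entryN, entryZ, entry0) => ?; lra.
have D0 y1 y2 : form v y1 = 0 -> form v y2 = 0 -> D y1 *m y2 = 0.
  move=> h1 h2; apply: form_ext_perp; last first.
    by rewrite form0r -[LHS]opprK -form_skew// Dv form0l oppr0.
  move=> y3 h3; rewrite form0r; pose T a b c := form a (D b *m c).
  have Ts a b c : form v b = 0 -> form v c = 0 -> T a b c = T a c b.
    by move=> hb hc; rewrite /T Dsym.
  have Ta a b c : T a b c = - T c b a by rewrite /T formC form_skew.
  have := Ta y3 y1 y2; rewrite (Ts y2 y1)// (Ta y2) opprK (Ts y1 y3)//.
  by rewrite (Ta y1) (Ts y3 y2)// /T => ?; lra.
move=> vy; rewrite sigmaM (_ : D y = 0) ?scaler0 ?sub0r//.
apply: mulmx_ext => z; rewrite mul0mx.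
have -> : z = (z - form v z *: v) + form v z *: v by rewrite subrK.
rewrite mulmxDr -scalemxAr Dv scaler0 addr0 D0// !formE v1; ring.
Qed.

(** [X] is the sum of a part that kills [v], fixed by [sigma], and of [wedge (X *m v) v], negated by
    it. So [sigma] is conjugation by the reflection in [v]. *)
Lemma sigmaE X : skew X -> sigma X = X - 2 *: wedge (X *m v) v.
Proof.
move=> sX; have vX : form v (X *m v) = 0 by exact: form_skew0.
have {1}-> : X = (X - wedge (X *m v) v) + wedge (X *m v) v by rewrite subrK.
have sw := @skew_wedge R p q (X *m v) v.
have sd : skew (X - wedge (X *m v) v) by apply: skewD => //; exact: skewN.
rewrite (autD sA)// sigma_wedge// sigma_fixed//; first by vector_ring.
by rewrite mulmxBl wedge_fix ?subrr// formC.
Qed.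

Lemma sigma_antifixed X : skew X -> sigma X = - X -> X = wedge (X *m v) v.
Proof.
move=> sX; rewrite sigmaE// => /matrixP h; apply/matrixP => i j.
by have := h i j; rewrite !(entryD, entryN, entryZ) => ?; lra.
Qed.

End SymmetricPair.

(** * Root spaces and the adapted frame *)

Section RootSpaces.
Variables (R : realType) (p q : nat).
Notation n := (p + q)%N.
Notation skew := (@skew R p q).
Implicit Types (X Y Z J : 'M[R]_n) (u v x y z w : 'cV[R]_n).

Lemma bracket_mul X Y y : bracket X Y *m y = X *m (Y *m y) - Y *m (X *m y).
Proof. by rewrite /bracket mulmxBl -!mulmxA. Qed.

Lemma bracketNl X Y : bracket (- X) Y = - bracket X Y.
Proof. by rewrite /bracket mulNmx mulmxN opprB opprK addrC. Qed.

(* Evaluate [[J, X] = X] at [v], at [u], and then at an arbitrary vector. *)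
Lemma root_one_wedge u v X : form v v = 1 -> form u v = 0 -> skew X ->
  bracket (wedge u v) X = X ->
  [/\ form v (X *m v) = 0, form u (X *m v) = 0,
      (1 + form u u) *: (X *m v) = 0 & X = wedge (X *m v) (v + u)].
Proof.
move=> v1 uv sX JX; set z := X *m v.
have vz : form v z = 0 by exact: form_skew0.
have JXE y : form v (X *m y) *: u - form u (X *m y) *: v
    - (form v y *: (X *m u) - form u y *: z) = X *m y.
  by rewrite -[in RHS]JX bracket_mul !wedgeE mulmxBr -!scalemxAr.
have Xu : X *m u = - form u z *: v - z.
  have := JXE v; rewrite -/z vz v1 uv => h.
  apply/matrixP => i j; have /matrixP/(_ i j) := h.
  by rewrite !(entryD, entryN, entryZ) => ?; lra.
have vXu : form v (X *m u) = - form u z.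
  by rewrite -[RHS]opprK -form_skew// opprK formC.
have uz : form u z = 0.
  have := congr1 (form v) (JXE u).
  by rewrite !formE vXu (form_skew0 u sX) (formC v u) uv vz v1 => ?; lra.
rewrite uz oppr0 scale0r sub0r in Xu.
split=> //.
  have := JXE u; rewrite vXu uz (form_skew0 u sX) (formC v u) uv Xu => h.
  apply/matrixP => i j; have /matrixP/(_ i j) := h.
  by rewrite !(entryD, entryN, entryZ, entry0) => ?; lra.
apply: mulmx_ext => y; rewrite -JXE Xu wedgeE !formE.
rewrite -[form v (X *m y)]opprK -(form_skew v y sX) -/z.
rewrite -[form u (X *m y)]opprK -(form_skew u y sX) Xu formNl.
by vector_ring.
Qed.

Section MinusEigenspace.
Variables (f : 'M[R]_n -> 'M[R]_n) (J1 J2 : 'M[R]_n).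
Hypothesis fA : involutive_automorphism skew f.

Lemma eigenspace_onN J : eigenspace_on skew f (-1) J ->
  eigenspace_on skew f (-1) (- J).
Proof. by move=> [sJ fJ]; split; [exact: skewN|rewrite (autN fA)// fJ scalerN]. Qed.

(** Keeping the labels and negating the pair, instead of negating the labels, lets every result on
    AN apply verbatim to A Nbar. *)
Lemma automorphism_root a b X : eigenspace_on skew f (-1) J1 ->
  eigenspace_on skew f (-1) J2 -> root_space skew J1 J2 a b X ->
  root_space skew (- J1) (- J2) a b (f X).
Proof.
have [fg _ brk _] := fA => -[s1 +] [s2 +]; rewrite !scaleN1r => f1 f2 [sX X1 X2].
split; first exact: fg.
  by rewrite -f1 -brk// X1 (autZ fA).
by rewrite -f2 -brk// X2 (autZ fA).
Qed.

End MinusEigenspace.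

Lemma automorphism_nilpotent (f : 'M[R]_n -> 'M[R]_n) (J1 J2 : 'M[R]_n) :
  involutive_automorphism skew f -> eigenspace_on skew f (-1) J1 ->
  eigenspace_on skew f (-1) J2 ->
  f @` nilpotent_part skew J1 J2 = nilpotent_part skew (- J1) (- J2).
Proof.
move=> fA f1 f2; have [_ _ _ inv] := fA.
have fsum Y1 Y2 Y3 Y4 : skew Y1 -> skew Y2 -> skew Y3 -> skew Y4 ->
    f (Y1 + Y2 + Y3 + Y4) = f Y1 + f Y2 + f Y3 + f Y4.
  by move=> s1 s2 s3 s4; rewrite !(autD fA)//; do ?apply: skewD.
have sub K1 K2 : eigenspace_on skew f (-1) K1 -> eigenspace_on skew f (-1) K2 ->
    f @` nilpotent_part skew K1 K2 `<=` nilpotent_part skew (- K1) (- K2).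
  move=> g1 g2 _ [X [Y1 [Y2 [Y3 [Y4 [r1 r2 r3 r4 ->]]]]] <-].
  exists (f Y1), (f Y2), (f Y3), (f Y4).
  split; try exact: (automorphism_root fA).
  by apply: fsum; [case: r1|case: r2|case: r3|case: r4].
apply/seteqP; split=> [|X NX]; first exact: sub.
have sX : skew X.
  have [Y1 [Y2 [Y3 [Y4 [[s1 _ _] [s2 _ _] [s3 _ _] [s4 _ _] ->]]]]] := NX.
  by do 3! apply: skewD => //.
exists (f X); last exact: inv.
(* [f X] is the preimage of [X]; it lies in the nilpotent part by the direct inclusion for the
   opposite pair. *)
rewrite -[J1]opprK -[J2]opprK; apply: sub; last by exists X.
  exact: eigenspace_onN.
exact: eigenspace_onN.
Qed.

End RootSpaces.

(** * Signature and orthonormal frames *)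

Section Signature.
Variables (R : realType) (m : nat).
Notation n := (2 + m)%N.

(** Three vectors have a nontrivial combination whose two positive coordinates vanish. Its norm is
    at most 0, yet orthogonality makes it a positive combination of the norms. *)
Lemma no_three_positive (s : 'I_3 -> 'cV[R]_n) :
  (forall i j, i != j -> form (s i) (s j) = 0) ->
  ~ (forall i, 0 < form (s i) (s i)).
Proof.
move=> so sp; pose M : 'M[R]_(3, 2) := \matrix_(i, j) s i (lshift m j) 0.
have /rowV0Pn[k /sub_kermxP kM k0] : kermx M != 0.
  rewrite -mxrank_eq0 mxrank_ker -lt0n subn_gt0.
  exact: leq_ltn_trans (rank_leq_col M) _.
pose y := \sum_i k 0 i *: s i.
have : form y y <= 0.
  rewrite form_sum big_split_ord /= big1 ?add0r => [|j _].
    apply: sumr_le0 => j _; rewrite /sgn_row row_mxEr mxE mulN1r oppr_le0.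
    exact: sqr_ge0.
  rewrite (_ : y _ _ = 0) ?mul0r ?mulr0//.
  rewrite /y summxE; have /matrixP/(_ 0 j) := kM; rewrite !mxE => kj.
  rewrite -[RHS]kj; by apply: eq_bigr => i _; rewrite !mxE.
apply/negP; rewrite -ltNge.
have -> : form y y = \sum_i k 0 i ^+ 2 * form (s i) (s i).
  have fy z : form z y = \sum_i k 0 i * form z (s i).
    by rewrite /y form_sumr; apply: eq_bigr => i _; rewrite formZr.
  rewrite fy; apply: eq_bigr => i _.
  rewrite formC fy (bigD1 i)//= big1 ?addr0 => [|j ji].
    by rewrite expr2 mulrA.
  by rewrite so ?mulr0 1?eq_sym.
have [i ki] : exists i, k 0 i != 0.
  by apply/existsP; apply: contraNT k0 => /existsPn h; apply/eqP/rowP => i;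
    rewrite mxE; apply/eqP/negPn/h.
rewrite (bigD1 i)//=; apply: ltr_pwDl.
  by rewrite mulr_gt0// exprn_even_gt0.
by apply: sumr_ge0 => j _; rewrite mulr_ge0 ?sqr_ge0// ltW.
Qed.

Lemma negative_complement (p1 p2 w : 'cV[R]_n) :
  form p1 p1 = 1 -> form p2 p2 = 1 -> form p1 p2 = 0 ->
  form p1 w = 0 -> form p2 w = 0 -> form w w <= 0.
Proof.
move=> h1 h2 h12 h1w h2w; rewrite leNgt; apply/negP => hw.
pose s (i : 'I_3) := nth 0 [:: p1; p2; w] i.
apply: (@no_three_positive s) => [[i hi] [j hj]|[i hi]]; rewrite /s /=; last first.
  by case: i hi => [|[|[|]]]//= _; rewrite ?h1 ?h2 ?ltr01.
move=> ij; have {ij} : i != j by [].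
case: i hi => [|[|[|]]]//= _; case: j hj => [|[|[|]]]//= _ _ //;
  by rewrite // formC.
Qed.

(** The index of [f] is that of [q_k], so [f 0] is the second positive vector and [f 1], ..., [f m]
    are the negative ones. Values beyond [m] are unconstrained. *)
Definition frame (v : 'cV[R]_n) (f : nat -> 'cV[R]_n) : Prop :=
  [/\ form v v = 1, form (f 0%N) (f 0%N) = 1,
      forall k, (k <= m)%N -> form v (f k) = 0,
      forall k, (0 < k <= m)%N -> form (f k) (f k) = -1
    & forall j k, (j < k <= m)%N -> form (f j) (f k) = 0].

(** The matrix [F] with the frame as columns satisfies [F^T eta F = eta], so its inverse is
    [eta F^T eta], and the expansion reads [y = F (eta F^T eta) y]. *)
Lemma frame_expand v f y : frame v f ->
  y = form v y *: v + form (f 0%N) y *: f 0%N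
      - \sum_(k < m) form (f k.+1) y *: f k.+1.
Proof.
move=> [v1 f0 vf fk fjk].
(* The indices shift by one: column 0 is [v] and column [i + 1] is [f i]. *)
pose e (i : 'I_n) := if nat_of_ord i is i'.+1 then f i' else v.
pose F : 'M[R]_n := \matrix_(i, j) e j i 0.
have colF i : col i F = e i.
  by apply/matrixP => a b; rewrite !mxE (ord1 b).
have ee i j : form (e i) (e j) = sigmx R 2 m i j.
  rewrite sigmx_diag !mxE; case: (eqVneq i j) => [->|ij]; last first.
    rewrite mulr0n /e; case: i j ij => [[|i] hi] [[|j] hj] //= ij.
    - exact: vf.
    - by rewrite formC; exact: vf.
    - have {ij} : i != j by [].
      by rewrite neq_ltn => /orP[h|h]; [|rewrite formC]; apply: fjk; rewrite h.
  rewrite mulr1n /sgn_row /e; case: (splitP j) => k jk; rewrite mxE jk.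
    by case: k {jk} => [[|[|]]].
  by rewrite fk//; exact: (ltn_ord k).
have FF : F^T *m sigmx R 2 m *m F = sigmx R 2 m.
  apply/matrixP => i j; rewrite -ee -!colF /form tr_col -row_mul.
  by rewrite [LHS]mxE [RHS]mxE; apply: eq_bigr => k _; rewrite [row _ _ _ _]mxE
    [col _ _ _ _]mxE.
have FFt : F *m (sigmx R 2 m *m F^T *m sigmx R 2 m) = 1%:M.
  by apply: mulmx1C; rewrite -!mulmxA (mulmxA F^T) FF sigmxK.
have Fy i : (F^T *m (sigmx R 2 m *m y)) i 0 = form (e i) y.
  by rewrite -colF /form -mulmxA tr_col -row_mul [RHS]mxE.
have yE : y = \sum_i sgn_row R 2 m 0 i *: (form (e i) y *: e i).
  rewrite -[LHS]mul1mx -FFt -!mulmxA; apply/matrixP => a b.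
  rewrite mxE summxE; apply: eq_bigr => i _; rewrite (ord1 b) 2!entryZ -colF.
  rewrite [col _ _ _ _]mxE {1}sigmx_diag mul_diag_mx [X in _ * X]mxE Fy colF.
  by rewrite [RHS]mulrA [RHS]mulrC.
have sgn_l (i : 'I_n) : (i < 2)%N -> sgn_row R 2 m 0 i = 1.
  by move=> i2; rewrite /sgn_row mxE; case: splitP => j ij; rewrite mxE//;
    rewrite ij in i2.
have sgn_r (i : 'I_n) : (1 < i)%N -> sgn_row R 2 m 0 i = -1.
  by move=> i2; rewrite /sgn_row mxE; case: splitP => j ij; rewrite mxE//;
    rewrite ij leqNgt ltn_ord in i2.
rewrite [LHS]yE big_ord_recl big_ord_recl addrA !sgn_l// !scale1r; congr (_ + _).
by rewrite -sumrN; apply: eq_bigr => i _; rewrite sgn_r// scaleN1r.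
Qed.

Lemma form_frame v f x y : frame v f ->
  form x y = form v x * form v y + form (f 0%N) x * form (f 0%N) y
    - \sum_(k < m) form (f k.+1) x * form (f k.+1) y.
Proof.
move=> vf; rewrite {1}(frame_expand y vf) !formE form_sumr.
rewrite !(formC x) mulrC [X in _ + X - _]mulrC; congr (_ - _).
by apply: eq_bigr => k _; rewrite formZr (formC x) mulrC.
Qed.

Lemma frame_ext v f (X Y : 'M[R]_n) : frame v f -> X *m v = Y *m v ->
  (forall k, (k <= m)%N -> X *m f k = Y *m f k) -> X = Y.
Proof.
move=> vf Xv Xf; apply: mulmx_ext => y; rewrite (frame_expand y vf).
rewrite !mulmxBr !mulmxDr -!scalemxAr Xv Xf// !mulmx_sumr; congr (_ - _).
by apply: eq_bigr => k _; rewrite -!scalemxAr Xf.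
Qed.

End Signature.

(** * The frame attached to the root vectors *)

Section RootFrame.
Variables (R : realType) (m : nat).
Notation n := (2 + m)%N.
Notation skew := (@skew R 2 m).
Variables (v : 'cV[R]_n) (sigma theta : 'M[R]_n -> 'M[R]_n).
Variables (J1 J2 Xpp : 'M[R]_n) (X0p : nat -> 'M[R]_n).
Hypothesis m1 : (1 < m)%N.
Hypothesis v1 : form v v = 1.
Hypothesis sA : involutive_automorphism skew sigma.
Hypothesis sH : eigenspace_on skew sigma 1 = [set X | skew X /\ X *m v = 0].
Hypothesis tA : involutive_automorphism skew theta.
Hypothesis st : forall X, skew X -> sigma (theta X) = theta (sigma X).
Hypothesis J1h : skew J1 /\ J1 *m v = 0.
Hypothesis J2q : eigenspace_on skew sigma (-1) J2.
Hypothesis J1p : eigenspace_on skew theta (-1) J1.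
Hypothesis J2p : eigenspace_on skew theta (-1) J2.
Hypothesis J12 : bracket J1 J2 = 0.
Hypothesis J2n0 : J2 != 0.
Hypothesis Xr : root_space skew J1 J2 1 1 Xpp.
Hypothesis Xb : bracket (theta Xpp) Xpp = 4%:R *: (J1 + J2).
Hypothesis Xkr : forall k, (3 <= k <= m)%N -> root_space skew J1 J2 0 1 (X0p k).
Hypothesis Xkb : forall k, (3 <= k <= m)%N ->
  bracket (theta (X0p k)) (X0p k) = 2%:R *: J2.
Hypothesis XkB : forall j k, (3 <= j <= m)%N -> (3 <= k <= m)%N -> j <> k ->
  killing skew (X0p j) (theta (X0p k)) = 0.

Let u := J2 *m v.
Let sJ1 : skew J1. Proof. by case: J1h. Qed.
Let J1v : J1 *m v = 0. Proof. by case: J1h. Qed.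
Let sJ2 : skew J2. Proof. by case: J2q. Qed.

Let uv : form u v = 0.
Proof. by rewrite formC; exact: form_skew0. Qed.

Let vu : form v u = 0. Proof. by rewrite formC. Qed.

Let J2E : J2 = wedge u v.
Proof.
by apply: (sigma_antifixed v1 sA sH) => //; have [_ ->] := J2q; rewrite scaleN1r.
Qed.

Let J1u : J1 *m u = 0.
Proof.
have := congr1 (mulmx^~ v) J12; rewrite /= bracket_mul J1v mulmx0 subr0 mul0mx.
by [].
Qed.

Let theta_root a b X := @automorphism_root _ _ _ theta J1 J2 tA a b X J1p J2p.

Let bp := v + u.
Let bm := v - u.

Let root_p a X : root_space skew J1 J2 a 1 X ->
  [/\ form v (X *m v) = 0, form u (X *m v) = 0,
      (1 + form u u) *: (X *m v) = 0, X = wedge (X *m v) bp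
      & J1 *m (X *m v) = a *: (X *m v)].
Proof.
move=> [sX X1 X2]; have [h1 h2 h3 h4] := @root_one_wedge _ _ _ u v X v1 uv sX
  (etrans (congr1 (fun J => bracket J X) (esym J2E)) (etrans X2 (scale1r _))).
split=> //; have := congr1 (mulmx^~ v) X1; rewrite /= bracket_mul J1v mulmx0.
by rewrite subr0 -scalemxAl.
Qed.

Let root_m a X : root_space skew (- J1) (- J2) a 1 X ->
  [/\ form v (X *m v) = 0, form u (X *m v) = 0, X = wedge (X *m v) bm
      & J1 *m (X *m v) = - a *: (X *m v)].
Proof.
move=> [sX X1 X2]; have uv' : form (- u) v = 0 by rewrite formNl uv oppr0.
have X2' : bracket (wedge (- u) v) X = X by rewrite wedgeNl -J2E X2 scale1r.
have [h1 h2 h3 h4] := root_one_wedge v1 uv' sX X2'.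
split=> //; first by move: h2; rewrite formNl => ?; lra.
have := congr1 (mulmx^~ v) X1; rewrite /= bracket_mul !mulNmx J1v oppr0 mulmx0.
by rewrite subr0 -scalemxAl scaleNr => <-; rewrite opprK.
Qed.

(** Evaluated at [v], the normalization of [[theta X, X]] becomes the value of an inner product
    between [X v] and [theta X v]. *)
Let bracket_bm_bp w w' : form v w = 0 -> form u w = 0 -> form v w' = 0 ->
  form u w' = 0 -> bracket (wedge w' bm) (wedge w bp) *m v = (2 * form w w') *: u.
Proof.
move=> h1 h2 h3 h4; rewrite bracket_mul !wedgeE.
rewrite /bp /bm !formE !(formC _ v) !(formC _ u) v1 uv h1 h2 h3 h4 (formC w').
by vector_ring.
Qed.

Let z := Xpp *m v.
Let z' := theta Xpp *m v.

Let u_neq0 : u != 0.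
Proof. by apply: contra J2n0 => /eqP; rewrite [J2]J2E => ->; rewrite wedge0l. Qed.

Let zP := root_p Xr.
Let z'P := root_m (theta_root Xr).

Let zz'u : (2 * form z z') *: u = 4 *: u.
Proof.
have [h1 h2 _ h4 _] := zP; have [h1' h2' h4' _] := z'P.
rewrite -bracket_bm_bp// -h4 -h4' Xb -scalemxAl mulmxDl J1v add0r.
by rewrite -/u.
Qed.

Let zz' : form z z' = 2.
Proof.
have := zz'u => /eqP; rewrite -subr_eq0 -scalerBl scaler_eq0 (negbTE u_neq0) orbF.
by move=> /eqP ?; lra.
Qed.

(** A nonzero [z = X v], for a root vector [X] with [[J2, X] = X], forces [1 + <u, u> = 0]; and [z]
    is nonzero because [<z, z'> = 2]. *)
Let uu : form u u = -1.
Proof.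
have [_ _ + _ _] := zP; rewrite -/z => /eqP; rewrite scaler_eq0.
move=> /orP[/eqP ?|/eqP z0]; first by lra.
by move: zz'; rewrite z0 form0l => ?; lra.
Qed.

Let vz : form v z = 0. Proof. by case: zP. Qed.
Let vz' : form v z' = 0. Proof. by case: z'P. Qed.
Let uz : form u z = 0. Proof. by case: zP. Qed.
Let uz' : form u z' = 0. Proof. by case: z'P. Qed.
Let J1z : J1 *m z = z. Proof. by case: zP => _ _ _ _; rewrite scale1r. Qed.
Let J1z' : J1 *m z' = - z'. Proof. by case: z'P => _ _ _; rewrite scaleN1r. Qed.
Let zz : form z z = 0.
Proof. by have := form_skew0 z sJ1; rewrite J1z. Qed.
Let zz'' : form z' z' = 0.
Proof. by have := form_skew0 z' sJ1; rewrite J1z' formNr => ?; lra. Qed.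

(** The null vectors [z] and [z'], of weights 1 and -1 under [J1], are thus [t + x] and [t - x]. *)
Let t := 2^-1 *: (z + z').
Let x := 2^-1 *: (z - z').

Let tt : form t t = 1.
Proof. by rewrite /t !formE zz zz'' (formC z') zz'; lra. Qed.

Let w k := X0p k *m v.

(** The bracket relation makes [theta (X0p k) v] a multiple [a] of [w k] with [a <w k, w k> = 1],
    and [theta] being an involution gives [a ^+ 2 = 1]. As [w k] is orthogonal to the positive
    vectors [v] and [t], its norm is not positive, so [a = -1]. *)
Lemma X0p_wedge k : (3 <= k <= m)%N ->
  [/\ form v (w k) = 0, form u (w k) = 0, J1 *m w k = 0, form (w k) (w k) = -1
    & X0p k = wedge (w k) bp /\ theta (X0p k) = - wedge (w k) bm].
Proof.
move=> km; have [h1 h2 _ h4 h5] := root_p (Xkr km).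
have [h1' h2' h4' h5'] := root_m (theta_root (Xkr km)).
rewrite -/(w k) in h1 h2 h4 h5.
set w' := theta (X0p k) *m v in h1' h2' h4' h5'.
rewrite scale0r in h5.
have ww' : form (w k) w' = 1.
  have : (2 * form (w k) w') *: u = 2 *: u.
    by rewrite -bracket_bm_bp// -h4 -h4' Xkb// -scalemxAl.
  move=> /eqP; rewrite -subr_eq0 -scalerBl scaler_eq0 (negbTE u_neq0) orbF.
  by move=> /eqP ?; lra.
(* [J2] kills [w'], so the bracket, a multiple of [J2], does too; expanding it at [w'] gives the
   relation. *)
have w'E : w' = form w' w' *: w k.
  have : bracket (wedge w' bm) (wedge (w k) bp) *m w' = 0.
    rewrite -h4 -h4' Xkb// -scalemxAl J2E wedgeE h1' h2'.
    by rewrite !scale0r subr0 scaler0.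
  rewrite bracket_mul !wedgeE /bp /bm !formE.
  rewrite !(formC _ v) !(formC _ u) v1 uv uu h1 h2 h1' h2' ww' => h.
  apply/matrixP => i j; have /matrixP/(_ i j) := h.
  by rewrite !(entryD, entryN, entryZ, entry0) => ?; lra.
set a := form w' w' in w'E.
have [_ _ _ inv] := tA; have [sg _ _ _] := tA.
have [sX _ _] := Xkr km.
(* [sigma] exchanges [wedge y bp] and [- wedge y bm], so commuting with it transports the formula
   for [theta] on the [bp] side to the [bm] side. *)
have tX : theta (wedge (w k) bm) = wedge w' bp.
  have := st sX; rewrite (sigmaE v1 sA sH)//; last exact: sg.
  rewrite (sigmaE v1 sA sH)// -/(w k) -/w' h4' h4.
  rewrite (_ : wedge (w k) bp - _ = - wedge (w k) bm); last first.
    by rewrite /bp /bm !wedgeDr wedgeNr; vector_ring.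
  rewrite (autN tA); last exact: skew_wedge.
  move=> e; rewrite -[LHS]opprK -e /bp /bm !wedgeDr wedgeNr; vector_ring.
have wa : w k = a ^+ 2 *: w k.
  have := congr1 (mulmx^~ v) (inv _ sX); rewrite /= h4' w'E wedgeZl (autZ tA);
    last exact: skew_wedge.
  rewrite tX -scalemxAl wedgeE /bp !formE v1 uv addr0 (formC w') h1'.
  by rewrite scale1r scale0r subr0 w'E scalerA -expr2 => /esym.
have a2 : a ^+ 2 = 1.
  by have := congr1 (fun y : 'cV[R]_n => form y w') wa; rewrite /= formZl ww' mulr1.
have wwa : a * form (w k) (w k) = 1 by rewrite -ww' w'E formZr.
have tw : form t (w k) = 0.
  have zw : form z (w k) = 0 by rewrite -J1z form_skew// h5 form0r oppr0.
  have z'w : form z' (w k) = 0.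
    by rewrite -[z']opprK -J1z' formNl form_skew// h5 form0r !oppr0.
  by rewrite /t !formE zw z'w; lra.
have vt : form v t = 0 by rewrite /t !formE vz vz'; lra.
have wneg := negative_complement v1 tt vt h1 tw.
have am1 : a = -1.
  have /eqP : (a - 1) * (a + 1) = 0 by ring: a2.
  rewrite mulf_eq0 => /orP[|] /eqP ha; last by lra.
  by move: wwa; rewrite (_ : a = 1); last lra; move=> ?; lra.
split=> //; first by rewrite am1 in wwa; lra.
by split=> //; rewrite h4' w'E am1 scaleN1r wedgeNl.
Qed.

Let q := qvec sigma theta J1 J2 Xpp X0p.

Let q0E : q 0%N = wedge t v.
Proof.
have [sX _ _] := Xr; have [sg _ _ _] := tA.
rewrite /q /= !(sigmaE v1 sA sH)//; last exact: sg.
rewrite -/z -/z' /t wedgeZl wedgeDl.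
by vector_entries; field.
Qed.

Let J1t : J1 *m t = x.
Proof. by rewrite /t -scalemxAr mulmxDr J1z J1z'. Qed.

Let J1x : J1 *m x = t.
Proof. by rewrite /x -scalemxAr mulmxBr J1z J1z' opprK. Qed.

Let q2E : q 2%N = wedge (- x) v.
Proof.
have -> : q 2%N = - bracket J1 (q 0%N) by [].
by rewrite q0E bracket_wedge// J1t J1v wedgeNl (wedgeC t) wedge0l oppr0 addr0.
Qed.

Let qkE k : (3 <= k <= m)%N -> q k = wedge (w k) v.
Proof.
move=> km; have [_ _ _ _ [Xk tXk]] := X0p_wedge km.
rewrite (_ : q k = 2%:R^-1 *: (X0p k - theta (X0p k))); last first.
  by case: k km {Xk tXk} => [|[|[|]]].
rewrite tXk Xk /bp /bm !wedgeDr wedgeNr.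
by vector_entries; field.
Qed.

Let vt : form v t = 0. Proof. by rewrite /t !formE vz vz'; lra. Qed.
Let vx : form v x = 0. Proof. by rewrite /x !formE vz vz'; lra. Qed.

Let ww j k : (3 <= j <= m)%N -> (3 <= k <= m)%N -> j <> k -> form (w j) (w k) = 0.
Proof.
move=> jm km jk; have := XkB jm km jk.
have [h1 h2 h3 h4 [Xj _]] := X0p_wedge jm.
have [h1' h2' h3' h4' [Xk tXk]] := X0p_wedge km.
have sN : skew (- wedge (w k) bm) by apply: skewN; exact: skew_wedge.
have [sX _ _] := Xkr jm.
rewrite tXk killing_skew// -wedgeNl tr_wedge// Xj wedgeE.
rewrite /bp /bm !formE !(formC _ v) !(formC _ u) v1 uv uu h1 h2 h1' h2'.
move=> /eqP; rewrite mulf_eq0 => /orP[|/eqP ?]; last by lra.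
(* The other factor is [n - 2 = m], which is nonzero. *)
by rewrite natrD addrC addKr pnatr_eq0 -leqn0 leqNgt (ltn_trans _ m1).
Qed.

Let f k := q k *m v.

Let wedge_v y : form v y = 0 -> wedge y v *m v = y.
Proof. by rewrite formC; exact: (wedge_fix v1). Qed.

Let fE k : (k <= m)%N -> f k = match k with
  0%N => t | 1%N => u | 2%N => - x | _ => w k end.
Proof.
move=> km; rewrite /f; case: k km => [_|[_|[_|k km]]].
- by rewrite q0E wedge_v.
- by [].
- by rewrite q2E; apply: wedge_v; rewrite formNr vx oppr0.
- by rewrite qkE// wedge_v//; have [] := X0p_wedge (k := k.+3) km.
Qed.

(** The normalizations of the root vectors are exhausted here: the rest of the argument knows [q_k],
    [J1] and [J2] only through the frame. *)
Lemma root_frame : [/\ frame v f, forall k, (k <= m)%N -> q k = wedge (f k) v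
  & J1 = wedge (f 0%N) (f 2%N)].
Proof.
have wP k : (k.+3 <= m)%N -> (3 <= k.+3 <= m)%N by [].
(* Eigenvectors of the skew [J1] for the eigenvalues 1 or -1 are orthogonal to its kernel. *)
have zw k : (k.+3 <= m)%N -> form z (w k.+3) = 0 /\ form z' (w k.+3) = 0.
  move=> km; have [_ _ h _ _] := X0p_wedge (wP k km); split.
    by rewrite -J1z form_skew// h form0r oppr0.
  by rewrite -[z']opprK -J1z' formNl form_skew// h form0r !oppr0.
have fP : frame v f.
  split=> //.
  - by rewrite fE.
  - move=> k km; rewrite fE//; case: k km => [|[|[|k]]] km //.
    + by rewrite formNr vx oppr0.
    + by have [] := X0p_wedge (wP k km).
  - move=> k /andP[k0 km]; rewrite fE//; case: k k0 km => [|[|[|k]]] // _ km.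
    + by rewrite /x !formE zz zz'' (formC z') zz'; lra.
    + by have [] := X0p_wedge (wP k km).
  - move=> j k /andP[jk km]; have jm := ltnW (leq_trans jk km).
    rewrite !fE//; case: k jk km => [|[|[|k]]] //; case: j jm => [|[|[|j]]] // jm jk km.
    + by rewrite /t !formE !(formC _ u) uz uz'; lra.
    + by rewrite /t /x !formE zz zz'' (formC z') zz'; lra.
    + by rewrite /x !formE uz uz'; lra.
    + by have [h1 h2] := zw k km; rewrite /t !formE h1 h2; lra.
    + by have [] := X0p_wedge (wP k km).
    + by have [h1 h2] := zw k km; rewrite /x !formE h1 h2; lra.
    + by apply: ww => // -[e]; rewrite e ltnn in jk.
split=> //.
  move=> k km; rewrite (fE km); case: k km => [|[|[|k]]] km.
  - exact: q0E.
  - exact: J2E.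
  - exact: q2E.
  - exact: qkE.
rewrite (fE (leq0n m)) (fE m1).
have [_ t1 vf fk fjk] := fP.
apply: (frame_ext fP) => [|k km].
  by rewrite J1v wedgeE formNl !(formC _ v) vt vx oppr0 !scale0r subr0.
rewrite fE// wedgeE; case: k km => [|[|[|k]]] km.
- rewrite J1t tt formNl.
  have -> : form x t = 0 by rewrite /t /x !formE zz zz'' (formC z') zz'; lra.
  by rewrite oppr0 scale0r sub0r scale1r opprK.
- rewrite J1u formNl.
  have -> : form x u = 0 by rewrite /x !formE !(formC _ u) uz uz'; lra.
  have -> : form t u = 0 by rewrite /t !formE !(formC _ u) uz uz'; lra.
  by rewrite oppr0 !scale0r subr0.
- rewrite mulmxN J1x formNl !formNr.
  have -> : form x x = -1 by rewrite /x !formE zz zz'' (formC z') zz'; lra.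
  have -> : form t x = 0 by rewrite /t /x !formE zz zz'' (formC z') zz'; lra.
  by rewrite oppr0 scale0r subr0 opprK scaleN1r.
- have [_ _ -> _ _] := X0p_wedge (wP k km); have [h1 h2] := zw k km.
  have hx : form x (w k.+3) = 0 by rewrite /x !formE h1 h2; lra.
  have ht : form t (w k.+3) = 0 by rewrite /t !formE h1 h2; lra.
  by rewrite formNl hx ht oppr0 !scale0r subr0.
Qed.

End RootFrame.

(** * Orbits of AN *)

Section NullTranslations.
Variables (R : realType) (p q : nat).
Notation n := (p + q)%N.
Implicit Types (X : 'M[R]_n) (x y z a b : 'cV[R]_n).

Lemma formM a X y : form a (X *m y) = ((a^T *m sigmx R p q) *m X *m y) 0 0.
Proof. by rewrite /form mulmxA. Qed.

Lemma continuous_form_mul a y : continuous (fun X => form a (X *m y)).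
Proof.
rewrite (_ : (fun X => _) = fun X => ((a^T *m sigmx R p q) *m X *m y) 0 0).
  exact: continuous_mul_entry.
by apply/funext => X; rewrite formM.
Qed.

Lemma row_skew a X : skew X ->
  a^T *m sigmx R p q *m X = - ((X *m a)^T *m sigmx R p q).
Proof.
by move=> sX; rewrite trmx_mul -[in RHS]mulmxA sX mulmxN opprK mulmxA.
Qed.

Lemma form_expm_eigen a X c y : skew X -> X *m a = c *: a ->
  form a (expm X *m y) = expR (- c) * form a y.
Proof.
move=> sX Xa; rewrite formM (@expm_eigenl _ _ _ _ (- c)).
  by rewrite -scalemxAl entryZ.
by rewrite row_skew// Xa linearZ /= -scalemxAl scaleNr.
Qed.

Lemma form_expm_nilpotent a b X c y : skew X -> X *m a = 0 ->
  X *m b = c *: a -> form b (expm X *m y) = form b y - c * form a y.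
Proof.
move=> sX Xa Xb; rewrite formM.
have bX : b^T *m sigmx R p q *m X = - c *: (a^T *m sigmx R p q).
  by rewrite row_skew// Xb linearZ /= -scalemxAl scaleNr.
have aX : a^T *m sigmx R p q *m X = 0.
  by rewrite row_skew// Xa linear0 mul0mx oppr0.
rewrite -[_ *m expm X]mulmx1 expm_mulE ?mulmx1 => [|k].
  rewrite bX -scalemxAl aX scaler0 scaler0 addr0 mulmxDl entryD -scalemxAl.
  by rewrite entryZ -/(form a y) -/(form b y) mulNr.
by rewrite !exprS -!mulmxE !mulmxA bX -!scalemxAl aX !mul0mx scaler0.
Qed.

(* A single unipotent fixing the null vector [a] carries [y] to any [y'] of the
   same norm with [<y', a> = <y, a>]. *)
Lemma null_translation a y y' : form a a = 0 -> form y a != 0 ->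
  form y' a = form y a -> form y' y' = form y y ->
  expm (wedge ((form y a)^-1 *: (y' - y)) a) *m y = y'.
Proof.
move=> aa ya y'a yy; set z := _ *: _; set X := wedge z a.
have za : form z a = 0 by rewrite /z !formE y'a subrr mulr0.
have Xa : X *m a = 0.
  by rewrite wedgeE aa (formC z) (formC a) za !scale0r subr0.
have Xz : X *m z = - form z z *: a.
  by rewrite wedgeE (formC a z) za scale0r sub0r scaleNr.
have X2 s : X *m (X *m s) = - (form s a * form z z) *: a.
  rewrite [X *m s]wedgeE mulmxBr -(scalemxAr _ X z) -(scalemxAr _ X a) Xa.
  rewrite scaler0 subr0 Xz scalerA.
  by rewrite mulrN (formC a).
rewrite -[expm X]mul1mx expm_mulE => [|k]; last first.
  rewrite mul1mx !exprS -!mulmxE -!mulmxA X2 form_skew; last exact: skew_wedge.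
  by rewrite Xa form0r oppr0 mul0r oppr0 scale0r.
(* The linear term contributes [y' - y] and a multiple of [a], the quadratic term another multiple
   of [a]; these two cancel because [y] and [y'] have the same norm. *)
rewrite !mul1mx -mulmxA X2 wedgeE scalerA (formC a) {1 2}/z scalerA mulfV//.
rewrite (formC _ y) /z !formE yy (formC y' y).
move: ya; set c := form y a => c0; vector_entries; field.
exact: c0.
Qed.

End NullTranslations.

(** * Closed orbits of AN as a zero locus *)

Section Orbits.
Variables (R : realType) (m : nat).
Notation n := (2 + m)%N.
Notation skew := (@skew R 2 m).
Notation G := (@SO R 2 m).
Variables (v t u x : 'cV[R]_n).
Hypothesis vtux : [/\ form v v = 1, form t t = 1, form u u = -1 & form x x = -1].
Hypothesis vtux0 : [/\ form v t = 0, form v u = 0 & form v x = 0] /\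
  [/\ form t u = 0, form t x = 0 & form u x = 0].
(** The null vectors [t + x] and [v + u] span an isotropic plane whose orthogonal contains no
    positive vector. Hence the two forms cannot vanish together at [g v], which has norm 1. *)
Hypothesis isotropic : forall y, form (t + x) y = 0 -> form (v + u) y = 0 ->
  form y y <= 0.

Notation J1 := (wedge x t).
Notation J2 := (wedge u v).
Notation H := (stabilizer G v).
Let a := t + x.
Let b := v + u.
Let a' := t - x.
Let b' := v - u.

Let v1 : form v v = 1. Proof. by case: vtux. Qed.
Let t1 : form t t = 1. Proof. by case: vtux. Qed.
Let u1 : form u u = -1. Proof. by case: vtux. Qed.
Let x1 : form x x = -1. Proof. by case: vtux. Qed.
Let vt : form v t = 0. Proof. by case: vtux0 => -[]. Qed.
Let vu : form v u = 0. Proof. by case: vtux0 => -[]. Qed.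
Let vx : form v x = 0. Proof. by case: vtux0 => -[]. Qed.
Let tu : form t u = 0. Proof. by case: vtux0 => _ []. Qed.
Let tx : form t x = 0. Proof. by case: vtux0 => _ []. Qed.
Let ux : form u x = 0. Proof. by case: vtux0 => _ []. Qed.
Let gramC := (formC t v, formC u v, formC x v, formC u t, formC x t, formC x u).

Ltac gram := rewrite ?formE ?gramC ?v1 ?t1 ?u1 ?x1 ?vt ?vu ?vx ?tu ?tx ?ux.

Let aa : form a a = 0. Proof. by rewrite /a; gram; lra. Qed.
Let bb : form b b = 0. Proof. by rewrite /b; gram; lra. Qed.
Let ab : form a b = 0. Proof. by rewrite /a /b; gram; lra. Qed.
Let bb' : form b b' = 2. Proof. by rewrite /b /b'; gram; lra. Qed.
Let av : form a v = 0. Proof. by rewrite /a; gram; lra. Qed.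

Let J1a : J1 *m a = a.
Proof. by rewrite wedgeE /a; gram; vector_ring. Qed.
Let J1b : J1 *m b = 0.
Proof. by rewrite wedgeE /b; gram; vector_ring. Qed.
Let J1b' : J1 *m b' = 0.
Proof. by rewrite wedgeE /b'; gram; vector_ring. Qed.
Let J2a : J2 *m a = 0.
Proof. by rewrite wedgeE /a; gram; vector_ring. Qed.
Let J2b : J2 *m b = b.
Proof. by rewrite wedgeE /b; gram; vector_ring. Qed.
Let J2b' : J2 *m b' = - b'.
Proof. by rewrite wedgeE /b'; gram; vector_ring. Qed.
Let J1v : J1 *m v = 0.
Proof. by rewrite wedgeE; gram; vector_ring. Qed.

Notation NN := (nilpotent_part skew J1 J2).
Notation AA := [set X : 'M[R]_n | exists c d : R, X = c *: J1 + d *: J2].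
Notation K := (mul_set (connected_subgroup AA) (connected_subgroup NN)).

Let J1_eigen (c : R) (z : 'cV[R]_n) : J1 *m z = c *: z -> c != 0 -> c ^+ 2 != 1 -> z = 0.
Proof.
rewrite wedgeE => h c0 c1; have h1 := congr1 (@form R 2 m t) h.
have h2 := congr1 (@form R 2 m x) h; move: h1 h2; gram => h1 h2.
have xz : form x z = - (c * form t z) by lra.
have tz : form t z = 0.
  have /eqP : (c ^+ 2 - 1) * form t z = 0 by rewrite xz in h2; lra.
  by rewrite mulf_eq0 subr_eq0 (negbTE c1) => /eqP.
rewrite tz mulr0 oppr0 in xz.
move: h; rewrite tz xz !scale0r subr0 => /esym/eqP.
by rewrite scaler_eq0 (negbTE c0) => /eqP.
Qed.

Let J1_fix (z : 'cV[R]_n) : J1 *m z = z -> z = form t z *: a.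
Proof.
rewrite wedgeE => h; have := congr1 (@form R 2 m t) h; gram => h1.
by rewrite -[LHS]h (_ : form x z = - form t z); [rewrite /a; vector_ring|lra].
Qed.

Let J2E1 (X : 'M[R]_n) : bracket J2 X = X -> skew X ->
  [/\ form v (X *m v) = 0, form u (X *m v) = 0 & X = wedge (X *m v) b].
Proof.
by move=> h sX; have [] := root_one_wedge v1 (etrans (formC u v) vu) sX h.
Qed.

(** Weights explain this. Roots with first entry 1 would move [a] to weight 2 of [J1], which does
    not occur. Roots with second entry 1 are wedges with [b] and kill it, the root (1, 0) kills it
    as well, and only (1, -1) can send [b] to the line of [a]. *)
Let nil_kills (X : 'M[R]_n) : NN X -> [/\ skew X, X *m a = 0 & exists c, X *m b = c *: a].
Proof.
move=> [Y1 [Y2 [Y3 [Y4 [h1 h2 h3 h4 ->]]]]].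
have J1X (Y : 'M[R]_n) c : bracket J1 Y = c *: Y -> J1 *m (Y *m v) = c *: (Y *m v).
  move=> /(congr1 (mulmx^~ v)) /=.
  by rewrite bracket_mul J1v mulmx0 subr0 -scalemxAl.
have ka (Y : 'M[R]_n) d : root_space skew J1 J2 1 d Y -> Y *m a = 0.
  move=> [_ e1 _]; apply: (@J1_eigen 2).
  - have := congr1 (mulmx^~ a) e1; rewrite /= bracket_mul J1a scale1r => e.
    by apply/eqP; rewrite -subr_eq0 scaler_nat mulr2n opprD addrA e subrr.
  - by rewrite pnatr_eq0.
  - by rewrite -natrX pnatr_eq1.
have K1 : Y1 *m b = 0.
  have [s1 _ e2] := h1; rewrite scale1r in e2; have [g1 g2 {1}->] := J2E1 e2 s1.
  by rewrite wedgeE bb {1}/b !formE !(formC _ v) !(formC _ u) g1 g2 addr0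
    !scale0r subr0.
have K4 : Y4 *m b = 0.
  have [s1 _ e2] := h4; rewrite scale1r in e2; have [g1 g2 {1}->] := J2E1 e2 s1.
  by rewrite wedgeE bb {1}/b !formE !(formC _ v) !(formC _ u) g1 g2 addr0
    !scale0r subr0.
have K4a : Y4 *m a = 0.
  have [s1 e1 e2] := h4; rewrite scale1r in e2; have [_ _ ->] := J2E1 e2 s1.
  have e1v := J1X _ _ e1; rewrite scale0r in e1v.
  have za : form (Y4 *m v) a = 0.
    have := form_skew (Y4 *m v) a (skew_wedge x t).
    by rewrite e1v J1a form0l => ?; lra.
  by rewrite wedgeE (formC b) ab za !scale0r subr0.
have J2u : J2 *m u = v by rewrite wedgeE; gram; vector_ring.
have J2v : J2 *m v = u by rewrite wedgeE; gram; vector_ring.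
have K3 : Y3 *m b = 0.
  (* [[J2, Y3] = 0] is evaluated at [v], giving [Y3 u = 0], and then at [u], giving [Y3 v = 0]. *)
  have [s3 e1 e2] := h3; rewrite scale0r in e2.
  have := J1X _ _ e1; rewrite scale1r => /J1_fix Y3v.
  have := congr1 (mulmx^~ v) e2; rewrite /= bracket_mul J2v mul0mx Y3v.
  rewrite -scalemxAr J2a scaler0 sub0r => /eqP; rewrite oppr_eq0 => /eqP Y3u.
  have := congr1 (mulmx^~ u) e2; rewrite /= bracket_mul J2u mul0mx Y3u mulmx0.
  rewrite sub0r => /eqP; rewrite oppr_eq0 => /eqP Y3v0.
  by rewrite /b mulmxDr Y3u Y3v0 addr0.
have K2 : exists c, Y2 *m b = c *: a.
  have [s2 e1 e2] := h2; have := J1X _ _ e1; rewrite scale1r => /J1_fix Y2v.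
  have uv' : form (- u) v = 0 by gram; rewrite oppr0.
  have e2' : bracket (wedge (- u) v) Y2 = Y2.
    by rewrite wedgeNl bracketNl e2 scaleN1r opprK.
  have [g1 g2 _ Y2E] := root_one_wedge v1 uv' s2 e2'.
  exists (2 * form t (Y2 *m v)); rewrite {1}Y2E wedgeE (formC _ b) bb'.
  have -> : form (Y2 *m v) b = 0.
    by move: g2; rewrite /b !formE !(formC _ v) !(formC _ u) g1 => ?; lra.
  by rewrite scale0r subr0 {1}Y2v scalerA.
split.
- by have [? _ _] := h1; have [? _ _] := h2; have [? _ _] := h3;
    have [? _ _] := h4; do ! apply: skewD.
- by rewrite !mulmxDl (ka _ _ h1) (ka _ _ h2) (ka _ _ h3) K4a !addr0.
- by have [c cE] := K2; exists c; rewrite !mulmxDl K1 K3 K4 cE add0r !addr0.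
Qed.

Let AA_eigen (X : 'M[R]_n) : AA X ->
  [/\ skew X, exists c, X *m a = c *: a & exists c, X *m b = c *: b].
Proof.
move=> [c [d ->]]; split.
- by apply: skewD; apply: skewZ; exact: skew_wedge.
- by exists c; rewrite mulmxDl -!scalemxAl J1a J2a scaler0 addr0.
- by exists d; rewrite mulmxDl -!scalemxAl J1b J2b scaler0 add0r.
Qed.

(* The elements of [AN] scale the linear form [<a, .>], and scale [<b, .>]
   modulo [<a, .>]. *)
Let Kform : set 'M[R]_n := [set r | [/\ G r,
  exists2 c : R, 0 < c & forall y, form a (r *m y) = c * form a y
  & exists2 c : R, 0 < c & exists d, forall y,
      form b (r *m y) = c * form b y + d * form a y]].

Let Kform1 : Kform 1%:M.
Proof.
split; first exact: SO1.
  by exists 1 => // y; rewrite mul1mx mul1r.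
by exists 1 => //; exists 0 => y; rewrite mul1mx mul1r mul0r addr0.
Qed.

Let KformM r s : Kform r -> Kform s -> Kform (r *m s).
Proof.
move=> [Gr [c c0 rc] [d d0 [e rd]]] [Gs [c' c'0 sc] [d' d'0 [e' sd]]].
split; first exact: SO_mul.
  by exists (c * c'); rewrite ?mulr_gt0// => y; rewrite -mulmxA rc sc mulrA.
exists (d * d'); first exact: mulr_gt0.
exists (d * e' + e * c') => y; rewrite -mulmxA rd sd sc; ring.
Qed.

Let Kform_connected (S : set 'M[R]_n) : (forall X, S X -> Kform (expm X)) ->
  connected_subgroup S `<=` Kform.
Proof.
move=> SK _ [Xs XsS ->]; elim: Xs XsS => [|X Xs IH] XsS.
  by rewrite big_nil; exact: Kform1.
rewrite big_cons; apply: KformM.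
  by apply: SK; apply: XsS; rewrite mem_head.
by apply: IH => Y Ys; apply: XsS; rewrite in_cons Ys orbT.
Qed.

Let K_Kform : K `<=` Kform.
Proof.
move=> _ [r Ar [s Ns <-]]; apply: KformM.
  apply: Kform_connected Ar => X /AA_eigen[sX [c Xa] [d Xb]].
  split; first exact: SO_expm.
    by exists (expR (- c)); rewrite ?expR_gt0// => y; exact: form_expm_eigen.
  exists (expR (- d)); rewrite ?expR_gt0//; exists 0 => y.
  by rewrite mul0r addr0; exact: form_expm_eigen.
apply: Kform_connected Ns => X /nil_kills[sX Xa [c Xb]].
split; first exact: SO_expm.
  exists 1 => // y; rewrite (@form_expm_eigen _ _ _ _ _ 0) ?scale0r//.
  by rewrite oppr0 expR0.
exists 1 => //; exists (- c) => y.
by rewrite (form_expm_nilpotent _ sX Xa Xb) mul1r mulNr.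
Qed.

Let sub1 (S : set 'M[R]_n) X : S X -> connected_subgroup S (expm X).
Proof.
move=> SX; exists [:: X]; last by rewrite big_seq1.
by move=> Y; rewrite inE => /eqP ->.
Qed.

Let wedge_root c d (w z : 'cV[R]_n) c1 d1 c2 d2 : J1 *m w = c1 *: w ->
  J2 *m w = d1 *: w -> J1 *m z = c2 *: z -> J2 *m z = d2 *: z ->
  c = c1 + c2 -> d = d1 + d2 -> root_space skew J1 J2 c d (wedge w z).
Proof.
move=> w1 w2 z1 z2 -> ->; split; first exact: skew_wedge.
  rewrite bracket_wedge ?w1 ?z1; last exact: skew_wedge.
  by rewrite (wedgeC w (_ *: z)) !wedgeZl (wedgeC z) scalerN opprK scalerDl.
rewrite bracket_wedge ?w2 ?z2; last exact: skew_wedge.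
by rewrite (wedgeC w (_ *: z)) !wedgeZl (wedgeC z) scalerN opprK scalerDl.
Qed.

(** The weight-zero component of [z], orthogonal to all four frame vectors. The halves come from
    [<a, a'> = <b, b'> = 2]. *)
Let perp (z : 'cV[R]_n) := z - (form a' z / 2) *: a - (form a z / 2) *: a'
  - (form b' z / 2) *: b - (form b z / 2) *: b'.

Let perp_orth (z : 'cV[R]_n) : [/\ form t (perp z) = 0, form x (perp z) = 0,
  form u (perp z) = 0 & form v (perp z) = 0].
Proof. by rewrite /perp /a /a' /b /b'; split; gram; field. Qed.

Let perp_ker (z : 'cV[R]_n) : J1 *m perp z = 0 *: perp z /\
  J2 *m perp z = 0 *: perp z.
Proof.
have [h1 h2 h3 h4] := perp_orth z.
by rewrite !wedgeE h1 h2 h3 h4 !scale0r subrr.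
Qed.

Let root_zero c d : root_space skew J1 J2 c d 0.
Proof. by split; [exact: skew0| |]; rewrite /bracket mulmx0 mul0mx subrr scaler0. Qed.

Let rootZ c d e X : root_space skew J1 J2 c d X -> root_space skew J1 J2 c d (e *: X).
Proof.
have bZ (J : 'M[R]_n) : bracket J (e *: X) = e *: bracket J X.
  by rewrite /bracket -scalemxAr -scalemxAl scalerBr.
move=> [sX X1 X2]; split; first exact: skewZ.
  by rewrite bZ X1 !scalerA mulrC.
by rewrite bZ X2 !scalerA mulrC.
Qed.

Let Ja1 : J1 *m a = 1 *: a. Proof. by rewrite scale1r. Qed.
Let Ja2 : J2 *m a = 0 *: a. Proof. by rewrite scale0r. Qed.
Let Jb1 : J1 *m b = 0 *: b. Proof. by rewrite scale0r. Qed.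
Let Jb2 : J2 *m b = 1 *: b. Proof. by rewrite scale1r. Qed.
Let Jb'1 : J1 *m b' = 0 *: b'. Proof. by rewrite scale0r. Qed.
Let Jb'2 : J2 *m b' = -1 *: b'. Proof. by rewrite scaleN1r. Qed.

Let wedge_perp (z c : 'cV[R]_n) : wedge (perp z) c = wedge z c
  - (form a' z / 2) *: wedge a c - (form a z / 2) *: wedge a' c
  - (form b' z / 2) *: wedge b c - (form b z / 2) *: wedge b' c.
Proof.
(* Generalizing keeps [wedgeDl] from splitting [a], [a'], [b], [b'] into frame vectors. *)
rewrite /perp; move: (a) (a') (b) (b') => a1 a2 b1 b2.
by rewrite !wedgeDl !wedgeNl !wedgeZl.
Qed.

(** Without a component along [a'], [wedge z a] only has the weights (1, 1), (1, -1) and (1, 0).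
    This places the null translations along [a] in N. *)
Let wedge_a_nil (z : 'cV[R]_n) : form z a = 0 -> NN (wedge z a).
Proof.
move=> za; have [p1 p2] := perp_ker z.
exists ((form b' z / 2) *: wedge b a), ((form b z / 2) *: wedge b' a),
  (wedge (perp z) a), 0; split.
- by apply: rootZ; apply: (wedge_root Jb1 Jb2 Ja1 Ja2); lra.
- by apply: rootZ; apply: (wedge_root Jb'1 Jb'2 Ja1 Ja2); lra.
- by apply: (wedge_root p1 p2 Ja1 Ja2); lra.
- exact: root_zero.
rewrite wedge_perp (formC a z) za mul0r scale0r subr0 wedgexx scaler0.
by vector_ring.
Qed.

(** Here neither [a'] nor [b'] occurs in [z], so only the weights (1, 1) and (0, 1) remain.
    Orthogonality to [a] is what excludes the weight (-1, 1). *)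
Let wedge_b_nil (z : 'cV[R]_n) : form z a = 0 -> form z b = 0 -> NN (wedge z b).
Proof.
move=> za zb; have [p1 p2] := perp_ker z.
exists ((form a' z / 2) *: wedge a b), 0, 0, (wedge (perp z) b); split.
- by apply: rootZ; apply: (wedge_root Ja1 Ja2 Jb1 Jb2); lra.
- exact: root_zero.
- exact: root_zero.
- by apply: (wedge_root p1 p2 Jb1 Jb2); lra.
rewrite wedge_perp (formC a z) (formC b z) za zb !mul0r !scale0r !subr0.
by rewrite wedgexx scaler0; vector_ring.
Qed.

(** As [<c, y>] and [<c, y'>] have the same sign, some [expm (s *: J)] matches their values; a null
    translation along [c] does the rest. *)
Let transitive_on J c (y y' : 'cV[R]_n) : (forall s, AA (s *: J)) -> skew J ->
  J *m c = c -> form c c = 0 -> form y y = form y' y' ->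
  0 < form c y * form c y' ->
  (forall s y1, expm (s *: J) *m y1 = y' -> form y1 c = form y c ->
    NN (wedge ((form y c)^-1 *: (y1 - y)) c)) ->
  exists2 r, K r & r *m y = y'.
Proof.
move=> AsJ sJ Jc cc yy' cyy' nil.
have y0 : form c y != 0 by apply: contraTneq cyy' => ->; rewrite mul0r ltxx.
have y'0 : form c y' != 0 by apply: contraTneq cyy' => ->; rewrite mulr0 ltxx.
pose rho := form c y / form c y'.
have rho0 : 0 < rho.
  rewrite /rho (_ : _ / _ = (form c y * form c y') / form c y' ^+ 2); last first.
    by field.
  by rewrite divr_gt0// exprn_even_gt0.
pose s := ln rho; have sE : expR s = rho by rewrite lnK// posrE.
have sK : skew (s *: J) by exact: skewZ.
have [g Gg [g1 g2]] := SO_inv (SO_expm sK); pose y1 := g *m y'.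
have y1E : expm (s *: J) *m y1 = y' by rewrite /y1 mulmxA g2 mul1mx.
have y1c : form c y1 = form c y.
  have := @form_expm_eigen _ _ _ c _ s y1 sK; rewrite -scalemxAl Jc y1E => h.
  have /(congr1 ( *%R (expR s))) := h erefl.
  by rewrite mulrA -expRD subrr expR0 mul1r sE /rho divfK.
have yc : form y1 c = form y c by rewrite formC y1c formC.
have y1y1 : form y1 y1 = form y y by rewrite /y1 SO_form.
exists (expm (s *: J) *m expm (wedge ((form y c)^-1 *: (y1 - y)) c)).
  exists (expm (s *: J)); first exact: sub1 (AsJ s).
  by eexists; last reflexivity; apply: sub1; exact: nil y1E yc.
have yc0 : form y c != 0 by rewrite formC.
by rewrite -mulmxA (null_translation cc yc0 yc y1y1).
Qed.

Let AA1 (s : R) : AA (s *: J1).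
Proof. by exists s, 0; rewrite scale0r addr0. Qed.

Let AA2 (s : R) : AA (s *: J2).
Proof. by exists 0, s; rewrite scale0r add0r. Qed.

Let transitive_a (y y' : 'cV[R]_n) : form y y = form y' y' ->
  0 < form a y * form a y' -> exists2 r, K r & r *m y = y'.
Proof.
move=> yy' ayy'; apply: (@transitive_on J1 a) => //; first exact: skew_wedge.
move=> s y1 _ y1y; apply: wedge_a_nil.
by rewrite formZl formDl formNl y1y subrr mulr0.
Qed.

Let transitive_b (y y' : 'cV[R]_n) : form y y = form y' y' ->
  form a y = 0 -> form a y' = 0 ->
  0 < form b y * form b y' -> exists2 r, K r & r *m y = y'.
Proof.
move=> yy' ay ay' byy'; apply: (@transitive_on J2 b) => //; first exact: skew_wedge.
move=> s y1 y1y' y1y; apply: wedge_b_nil; last first.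
  by rewrite formZl formDl formNl y1y subrr mulr0.
have y1a : form y1 a = 0.
  rewrite formC -ay' -y1y' (@form_expm_eigen _ _ _ _ _ 0).
  - by rewrite oppr0 expR0 mul1r.
  - by apply: skewZ; exact: skew_wedge.
  - by rewrite -scalemxAl J2a scaler0 scale0r.
by rewrite formZl formDl formNl y1a (formC y a) ay subrr mulr0.
Qed.

(* If [<a, g v> <> 0], the orbit is a half [<a, .> > 0] or [<a, .> < 0]: its
   preimage is open and proper in the connected group [G], hence not closed.
   If [<a, g v> = 0], then [<b, .>] does not vanish on the orbit, which is
   therefore cut out by [<a, .> = 0] and a weak inequality on [<b, .>]. *)
Lemma closed_orbitsP (X : set 'M[R]_n) : closed_orbits G H K X <->
  exists g, [/\ G g, X = lcls H g & form a (g *m v) = 0].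
Proof.
have orbP g h : G g -> G h ->
    orbit_of H K g (lcls H h) <-> exists2 r, K r & r *m (g *m v) = h *m v.
  move=> Gg Gh; split=> [[r Kr]|[r Kr e]].
    have [Gr _ _] := K_Kform Kr.
    by move=> /lclsP e; exists r; rewrite // mulmxA e//; exact: SO_mul.
  have [Gr _ _] := K_Kform Kr.
  by exists r => //; apply/lclsP => //; [exact: SO_mul|rewrite -mulmxA].
have vv g h : G g -> G h -> form (g *m v) (g *m v) = form (h *m v) (h *m v).
  by move=> Gg Gh; rewrite !SO_form.
have cF (c : R) (a0 : 'cV[R]_n) :
    continuous (fun h : 'M[R]_n => c * form a0 (h *m v)).
  move=> h; apply: (@cvgM _ _ (nbhs h) _ (fun=> c)); first exact: cvg_cst.
  exact: continuous_form_mul.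
split.
  move=> [g [Gg cl [r Kr <-]]]; have [Gr [c c0 rc] _] := K_Kform Kr.
  exists (r *m g); split => //; first exact: SO_mul.
  rewrite -mulmxA rc (_ : form a (g *m v) = 0) ?mulr0//.
  apply: contrapT => /eqP ga.
  pose pos := [set h : 'M[R]_n | 0 < form a (g *m v) * form a (h *m v)].
  have posE h : G h -> orbit_of H K g (lcls H h) <-> pos h.
    move=> Gh; rewrite orbP//; split=> [[s Ks e]|ph].
      have [_ [d d0 sd] _] := K_Kform Ks.
      rewrite /pos /= -e sd mulrCA mulr_gt0// -expr2.
      by rewrite exprn_even_gt0.
    by apply: transitive_a => //; exact: vv.
  have [V cV VE] := proj1 (closed_subspaceP _ _) cl.
  have VpE : G `&` V = G `&` pos.
    apply/seteqP; split=> h [Gh hV]; split => //.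
      by apply/posE => //; have [+ _] : ([set h | orbit_of H K g (lcls H h)] `&` G) h
        by rewrite -VE; split.
    have [] : (V `&` G) h by rewrite VE; split => //; apply/posE.
    by [].
  have : G `&` pos = G.
    apply: (@SO_connected R 2 m).
    - exists g; split => //; rewrite /pos /= -expr2.
      by rewrite exprn_even_gt0.
    - exists pos => //.
      exact: (proj1 (continuousP _) (@cF (form a (g *m v)) a) _ (@open_gt R 0)).
    - by exists V.
  (* The identity lies outside [pos] because [<a, v> = 0]. *)
  move=> /seteqP[_ /(_ 1%:M (SO1 R 2 m)) [_]].
  by rewrite /pos /= mul1mx av mulr0 ltxx.
move=> [g [Gg -> ga]].
have K1 : K 1%:M.
  exists 1%:M; first by exists [::]; rewrite ?big_nil.
  by exists 1%:M; [exists [::]; rewrite ?big_nil|rewrite mulmx1].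
have b_neq0 h : G h -> form a (h *m v) = 0 -> form b (h *m v) != 0.
  move=> Gh ha; apply/eqP => hb; have := isotropic ha hb.
  by rewrite SO_form// v1 ler10.
exists g; split => //; last first.
  by exists 1%:M => //; rewrite mul1mx.
apply/closed_subspaceP.
exists ([set h : 'M[R]_n | form a (h *m v) = 0] `&`
  [set h : 'M[R]_n | 0 <= form b (g *m v) * form b (h *m v)]).
  apply: closedI.
    exact: (proj1 (continuous_closedP _) (@continuous_form_mul R 2 m a v)
      _ (@closed_eq R 0)).
  exact: (proj1 (continuous_closedP _) (@cF (form b (g *m v)) b) _ (@closed_ge R 0)).
apply/seteqP; split=> h [].
  move=> [/= ha hb] Gh; split => //; apply/orbP => //.
  apply: transitive_b => //; first exact: vv.
  by rewrite lt_neqAle hb andbT eq_sym mulf_neq0// b_neq0.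
move=> + Gh; move=> /(orbP _ _ Gg Gh)[r Kr e].
have [Gr [c c0 rc] [d d0 [d' rd]]] := K_Kform Kr.
have ha : form a (h *m v) = 0 by rewrite -e rc ga mulr0.
split => //; split => //=; rewrite -e rd ga mulr0 addr0 mulrCA.
by rewrite mulr_ge0 ?(ltW d0)// -expr2 sqr_ge0.
Qed.

End Orbits.

(** * Light rays *)

Section LightRays.
Variables (R : realType) (m : nat).
Notation n := (2 + m)%N.
Notation G := (@SO R 2 m).
Variables (v : 'cV[R]_n) (f : nat -> 'cV[R]_n) (q : nat -> 'M[R]_n).
Hypothesis m1 : (1 < m)%N.
Hypothesis vf : frame v f.
Hypothesis qE : forall k, (k <= m)%N -> q k = wedge (f k) v.

Notation t := (f 0%N).
Notation u := (f 1%N).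
Notation x := (- f 2%N).
Notation H := (stabilizer G v).

Let v1 : form v v = 1. Proof. by case: vf. Qed.
Let t1 : form t t = 1. Proof. by case: vf. Qed.
Let vfk k : (k <= m)%N -> form v (f k) = 0. Proof. by case: vf => _ _ + _ _; apply. Qed.

Let tu : form t u = 0.
Proof. by have [_ _ _ fk fjk] := vf; apply: fjk; rewrite /= ltnW. Qed.
Let uu : form u u = -1.
Proof. by have [_ _ _ fk fjk] := vf; apply: fk; rewrite /= ltnW. Qed.
Let vu : form v u = 0.
Proof. by apply: vfk; exact: ltnW. Qed.
Let vt : form v t = 0. Proof. exact: vfk. Qed.
Let tx : form t (f 2%N) = 0.
Proof. by have [_ _ _ fk fjk] := vf; exact: fjk. Qed.
Let ux : form u (f 2%N) = 0.
Proof. by have [_ _ _ fk fjk] := vf; exact: fjk. Qed.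
Let vx : form v (f 2%N) = 0.
Proof. by exact: vfk. Qed.

Lemma frame_sum_ge (F : nat -> R) : (forall k, 0 <= F k) ->
  F 1%N + F 2%N <= \sum_(k < m) F k.+1.
Proof.
case: m m1 => [|[|m']] // _ F0.
by rewrite !big_ord_recl addrA lerDl; apply: sumr_ge0.
Qed.

Lemma frame_timelike_perp (y : 'cV[R]_n) : form v y = 0 -> form t y = 0 -> form y y <= 0.
Proof.
move=> vy ty; rewrite (form_frame y y vf) vy ty !mulr0 addr0 sub0r oppr_le0.
by apply: sumr_ge0 => k _; rewrite -expr2 sqr_ge0.
Qed.

Lemma frame_null_perp (y : 'cV[R]_n) : form v y = 0 -> form t y = 0 -> form y y = 0 -> y = 0.
Proof.
move=> vy ty; rewrite (form_frame y y vf) vy ty !mulr0 addr0 sub0r => /eqP.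
rewrite oppr_eq0 => /eqP /psumr_eq0P h.
rewrite (frame_expand y vf) vy ty !scale0r addr0 sub0r big1 ?oppr0// => k _.
have /eqP : form (f k.+1) y * form (f k.+1) y = 0.
  by apply: h => // i _; rewrite -expr2 sqr_ge0.
by rewrite mulf_eq0 orbb => /eqP ->; rewrite scale0r.
Qed.

(** The two equations make the squares along [v] and [t] equal to those along [u] and [x]; what
    remains of the norm is a sum of negative squares. *)
Lemma frame_isotropic (y : 'cV[R]_n) : form (t + x) y = 0 -> form (v + u) y = 0 ->
  form y y <= 0.
Proof.
rewrite !formE => h1 h2; rewrite (form_frame y y vf) subr_le0.
apply: le_trans (@frame_sum_ge (fun k => form (f k) y * form (f k) y) _); last first.
  by move=> k; rewrite -expr2 sqr_ge0.
have -> : form t y = form (f 2%N) y by lra.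
have -> : form v y = - form u y by lra.
by lra.
Qed.

Definition light_vector (w : 'rV[R]_m) : 'cV[R]_n :=
  t + \sum_(j < m) w 0 j *: f j.+1.

Lemma direction_wedge w : direction q w = wedge (light_vector w) v.
Proof.
rewrite /direction /light_vector wedgeDl qE//; congr (_ + _).
elim/big_rec2: _ => [|j y1 y2 _ ->]; first by rewrite wedge0l.
by rewrite wedgeDl wedgeZl qE.
Qed.

Lemma light_vector_form (w : 'rV[R]_m) : \sum_(j < m) w 0 j ^+ 2 = 1 ->
  [/\ form v (light_vector w) = 0, form t (light_vector w) = 1
    & form (light_vector w) (light_vector w) = 0].
Proof.
have [_ _ _ fk fjk] := vf.
move=> w1; have h1 : form v (light_vector w) = 0.
  rewrite /light_vector formDr vfk// form_sumr big1 ?addr0// => j _.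
  by rewrite formZr vfk ?mulr0.
have h2 : form t (light_vector w) = 1.
  rewrite /light_vector formDr t1 form_sumr big1 ?addr0// => j _.
  by rewrite formZr fjk ?mulr0//=.
split=> //; rewrite (form_frame _ _ vf) h1 h2 mul0r mul1r add0r.
apply/eqP; rewrite subr_eq0 -[X in X == _]w1; apply/eqP/eq_bigr => j _.
suff -> : form (f j.+1) (light_vector w) = - w 0 j by rewrite mulrNN expr2.
rewrite /light_vector formDr formC fjk//= add0r form_sumr (bigD1 j)//=.
rewrite formZr fk//= mulrN1 big1 ?addr0// => i ij; rewrite formZr.
have {ij} : (i : nat) != j by [].
rewrite neq_ltn => /orP[ij|ij]; last by rewrite fjk ?mulr0//= !ltnS ij ltn_ord.
by rewrite formC fjk ?mulr0//= !ltnS ij ltn_ord.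
Qed.

Lemma expm_light_vector (w : 'rV[R]_m) s : \sum_(j < m) w 0 j ^+ 2 = 1 ->
  expm (s *: direction q w) *m v = v + s *: light_vector w.
Proof.
move=> w1; have [h1 h2 h3] := light_vector_form w1.
set X := s *: _; have Xv : X *m v = s *: light_vector w.
  rewrite /X direction_wedge -scalemxAl wedgeE v1 (formC _ v) h1.
  by rewrite scale1r scale0r subr0.
have XXv : X *m (X *m v) = 0.
  rewrite Xv -scalemxAr /X direction_wedge -scalemxAl wedgeE h1 h3.
  by rewrite !scale0r subr0 !scaler0.
rewrite -[expm X]mul1mx expm_mulE => [|k].
  by rewrite !mul1mx -mulmxA XXv scaler0 addr0 Xv.
by rewrite mul1mx !exprSr -!mulmxE -!mulmxA XXv !mulmx0.
Qed.

Lemma SO_direction (w : 'rV[R]_m) s : G (expm (s *: direction q w)).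
Proof.
by apply: SO_expm; apply: skewZ; rewrite direction_wedge; exact: skew_wedge.
Qed.

(* The sign of this minor is the time orientation: it cannot vanish on [G],
   because [g v] and [g U] span a plane without negative vectors whereas the
   orthogonal of [v] and [t] is negative definite. *)
Lemma time_orientation (w : 'rV[R]_m) g : \sum_(j < m) w 0 j ^+ 2 = 1 -> G g ->
  0 < form v (g *m v) * form t (g *m light_vector w)
      - form t (g *m v) * form v (g *m light_vector w).
Proof.
move=> w1 Gg; have [h1 h2 h3] := light_vector_form w1; set U := light_vector w.
apply: (@connected_range_gt0 R _ G (fun g : 'M[R]_n =>
  form v (g *m v) * form t (g *m U) - form t (g *m v) * form v (g *m U))
  (@SO_connected R 2 m) _ _ 1%:M) => //.
- move=> h; apply: (@cvgB _ _ _ (nbhs h)); apply: (@cvgM _ _ (nbhs h));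
    exact: continuous_form_mul.
- move=> h Gh; apply/eqP => D0.
  have PP : form (h *m v) (h *m v) = 1 by rewrite SO_form.
  have PN : form (h *m v) (h *m U) = 0 by rewrite SO_form.
  have NN : form (h *m U) (h *m U) = 0 by rewrite SO_form.
  have tN : form (h *m t) (h *m U) = 1 by rewrite SO_form.
  set P := h *m v in D0 PP PN; set N := h *m U in D0 PN NN tN.
  (* The combination below is orthogonal to [t] by construction and to [v] by [D0]; its norm is
     [<t, N> ^+ 2], because [P] is a unit vector and [N] is null and orthogonal to [P]. *)
  have Nt : form t N = 0.
    have := @frame_timelike_perp (form t N *: P - form t P *: N).
    rewrite !formE (formC N P) PP PN NN => h4.
    have : form t N ^+ 2 <= 0 by have := h4 ltac:(lra) ltac:(lra) => ?; lra.
    by rewrite real_exprn_even_le0 ?num_real//= => /eqP.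
  have Nv : form v N = 0.
    have := @frame_timelike_perp (form v N *: P - form v P *: N).
    rewrite !formE (formC N P) PP PN NN => h4.
    have : form v N ^+ 2 <= 0 by have := h4 ltac:(lra) ltac:(lra) => ?; lra.
    by rewrite real_exprn_even_le0 ?num_real//= => /eqP.
  have N0 := frame_null_perp Nv Nt NN.
  by move: tN; rewrite N0 form0r => /eqP; rewrite eq_sym oner_eq0.
- exact: SO1.
- rewrite !mul1mx v1 h2 h1; lra.
Qed.

Variable S : set (set 'M[R]_n).
Hypothesis SE : forall X, S X <-> exists g, [/\ G g, X = lcls H g
  & form (t + x) (g *m v) = 0 \/ form (t - x) (g *m v) = 0].

Let S_lcls g : G g -> S (lcls H g) <->
  form (t + x) (g *m v) = 0 \/ form (t - x) (g *m v) = 0.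
Proof.
move=> Gg; split=> [/SE[h [Gh /lclsP gh]]|h]; first by rewrite gh.
by apply/SE; exists g.
Qed.

(* The ray starts at [v], which is singular, and leaves the singularity. *)
Lemma exists_escaping : exists2 X, homogeneous_space G H X &
  exists2 gamma, @lightlike_geodesic R n m G H q X gamma & escapes_future S gamma.
Proof.
(* Coordinate 0 of [w] belongs to [q_1], hence to [u]. *)
pose w : 'rV[R]_m := delta_mx 0 (Ordinal (ltnW m1)).
have w1 : \sum_(j < m) w 0 j ^+ 2 = 1.
  rewrite (bigD1 (Ordinal (ltnW m1)))//= big1 ?addr0 => [|j j0].
    by rewrite mxE !eqxx expr1n.
  by rewrite mxE (negbTE j0) expr0n.
have G1 := SO1 R 2 m.
exists (lcls H 1%:M); first by exists 1%:M.
exists (fun s => lcls H (1%:M *m expm (s *: direction q w))).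
  by exists 1%:M, w.
move=> s s0; have Gs := SO_direction w s.
have Uw : light_vector w = t + u.
  rewrite /light_vector (bigD1 (Ordinal (ltnW m1)))//= big1 ?addr0 => [|j j0].
    by rewrite mxE !eqxx scale1r.
  by rewrite mxE (negbTE j0) scale0r.
rewrite mul1mx S_lcls// expm_light_vector// Uw !formE !(formC _ v).
rewrite (formC (f 2%N) t) (formC (f 2%N) u) t1 tu tx ux vt vx.
by case=> ?; lra.
Qed.

Lemma exists_trapped : exists2 X, homogeneous_space G H X &
  forall gamma, @lightlike_geodesic R n m G H q X gamma -> intersects_future S gamma.
Proof.
(* [p0] is a rational substitute for a point [cos r *: v + sin r *: t] with
   [- pi / 2 < r < 0]: it is reached from [v] by a null translation. *)
pose b := v + u; pose p0 := (7/8) *: v - 2^-1 *: t - (1/8) *: u.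
(* Once the coefficient of [t] is set to -1/2, the conditions [<b, p0> = <b, v> = 1] and
   [<p0, p0> = 1] force the coefficients 7/8 and -1/8. *)
have [k Gk kv] : exists2 k, G k & k *m v = p0.
  eexists; last apply: (@null_translation _ _ _ b v p0).
  - by apply: SO_expm; exact: skew_wedge.
  - by rewrite /b !formE (formC u) v1 uu vu; lra.
  - by rewrite /b !formE v1 vu addr0 oner_neq0.
  - rewrite /b /p0 !formE !(formC _ v) tu uu vu vt v1; lra.
  - rewrite /p0 !formE !(formC _ v) (formC u t) tu uu vu vt v1 t1; lra.
exists (lcls H k); first by exists k.
move=> _ [g [w [Gg /lclsP kg w1 ->]]].
have {kg} gv : g *m v = p0 by rewrite -kg.
have [h1 h2 h3] := light_vector_form w1.
set U := light_vector w in h1 h2 h3; pose N := g *m U.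
have Gs s : G (g *m expm (s *: direction q w)).
  by apply: SO_mul => //; exact: SO_direction.
have gs s : g *m expm (s *: direction q w) *m v = p0 + s *: N.
  by rewrite -mulmxA expm_light_vector// mulmxDr gv -scalemxAr.
have D := time_orientation w1 Gg; rewrite gv -/U -/N in D.
have p0N : form p0 N = 0 by rewrite -gv SO_form.
have NN : form N N = 0 by rewrite SO_form.
have Nle : form u N * form u N <= form v N * form v N + form t N * form t N.
  move: NN; rewrite (form_frame N N vf) => NN.
  have h0 k0 : 0 <= form (f k0) N * form (f k0) N by rewrite -expr2 sqr_ge0.
  have := frame_sum_ge h0; have := h0 2%N; lra.
move: D p0N; rewrite /p0 !formE (formC t v) v1 vt vu tu t1 => D p0N.
(* Otherwise [D] makes [<v, N>] positive, and [<p0, N> = 0] gives [<u, N> = 7 <v, N> - 4 <t, N>],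
   too large for [Nle]. *)
have Nt : 0 < form t N.
  rewrite ltNge; apply/negP => Nt.
  have uN : form u N = 7 * form v N - 4 * form t N by lra.
  rewrite uN in Nle.
  have Nv : 0 < form v N by lra.
  have VV := mulr_gt0 Nv Nv; have TT := sqr_ge0 (form t N).
  have VT : 0 <= form v N * - form t N by rewrite mulr_ge0 ?oppr_ge0// ltW.
  by suff : (0 : R) < 0; [rewrite ltxx|lra].
have hit y : form y N > 0 -> form y p0 = - 2^-1 ->
    exists2 s, 0 < s & form y (p0 + s *: N) = 0.
  move=> yN yp; exists (2^-1 / form y N); first by rewrite divr_gt0.
  by rewrite formDr formZr yp divfK ?gt_eqF// addNr.
(* Both forms equal -1/2 at [p0]; the sign of [<x, N>] selects one that increases along [N]. *)
have [xN|xN] := leP 0 (form x N).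
- have [||s s0 sE] := hit (t + x).
  + by rewrite formDl; lra.
  + rewrite /p0 !formE !(formC _ v) (formC (f 2%N) t) (formC (f 2%N) u).
    by rewrite tu vt vx t1 tx ux; lra.
  by exists s => //; apply/S_lcls => //; left; rewrite gs.
- have [||s s0 sE] := hit (t - x).
  + by rewrite formDl formNl; lra.
  + rewrite /p0 !formE !(formC _ v) (formC (f 2%N) t) (formC (f 2%N) u).
    by rewrite tu vt vx t1 tx ux; lra.
  by exists s => //; apply/S_lcls => //; right; rewrite gs.
Qed.

End LightRays.

(** * Both families of orbits, and assembly of the theorem *)

Lemma span_pairE (R : realType) (n : nat) (X Y : 'M[R]_n) :
  [set Z | Z \in <<[:: X; Y]>>%VS] =
  [set Z | exists c d : R, Z = c *: X + d *: Y].
Proof.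
apply/seteqP; split=> Z /=; rewrite span_cons span_seq1.
  move=> /memv_addP[_ /vlineP[c ->] [_ /vlineP[d ->] ->]].
  by exists c, d.
move=> [c [d ->]]; apply: memv_add; first by rewrite memvZ ?memv_line.
by rewrite memvZ ?memv_line.
Qed.

Lemma span_pair_opp (R : realType) (n : nat) (X Y : 'M[R]_n) :
  [set Z | exists c d : R, Z = c *: - X + d *: - Y] =
  [set Z | exists c d : R, Z = c *: X + d *: Y].
Proof.
by apply/seteqP; split=> _ [c [d ->]]; exists (- c), (- d);
  vector_ring.
Qed.

Lemma frame_opp (R : realType) (m : nat) (v : 'cV[R]_(2 + m))
  (f : nat -> 'cV[R]_(2 + m)) :
  frame v f -> frame v (fun k => if k is 0%N then f 0%N else - f k).
Proof.
move=> [v1 f0 vf fk fjk]; split=> //.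
- by case=> [|k] km; rewrite ?formNr vf ?oppr0.
- by case=> // k km; rewrite formNl formNr opprK fk.
- move=> [|j] [|k] // jk; first by rewrite formNr fjk ?oppr0.
  by rewrite formNl formNr opprK fjk.
Qed.

(** [closed_orbitsP] is applied to the frame and to the one with [f 1] and [f 2] negated. The latter
    turns [J1], [J2] into their opposites, which leaves A unchanged and replaces N by Nbar. *)
Lemma singularity_frame (R : realType) (m : nat) (v : 'cV[R]_(2 + m))
  (f : nat -> 'cV[R]_(2 + m)) (theta : 'M[R]_(2 + m) -> 'M[R]_(2 + m))
  (J1 J2 : 'M[R]_(2 + m)) (X : set 'M[R]_(2 + m)) :
  (1 < m)%N -> frame v f -> J1 = wedge (f 0%N) (f 2%N) ->
  J2 = wedge (f 1%N) v ->
  theta @` nilpotent_part (@skew R 2 m) J1 J2 =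
    nilpotent_part (@skew R 2 m) (- J1) (- J2) ->
  singularity (@SO R 2 m) (stabilizer (@SO R 2 m) v) theta J1 J2 X <->
  exists g, [/\ @SO R 2 m g, X = lcls (stabilizer (@SO R 2 m) v) g
    & form (f 0%N + - f 2%N) (g *m v) = 0 \/
      form (f 0%N - - f 2%N) (g *m v) = 0].
Proof.
move=> m1 vf J1E J2E thetaN; have [v1 t1 vfk fk fjk] := vf.
rewrite /singularity lie_algebra_SO thetaN span_pairE /setU /=.
have m0 : (0 < m)%N := ltnW m1.
have tu : form (f 0%N) (f 1%N) = 0 by apply: fjk; rewrite /= m0.
have tx : form (f 0%N) (f 2%N) = 0 by exact: fjk.
have ux : form (f 1%N) (f 2%N) = 0 by exact: fjk.
have uu : form (f 1%N) (f 1%N) = -1 by apply: fk; rewrite /= m0.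
have xx : form (f 2%N) (f 2%N) = -1 by exact: fk.
have vt : form v (f 0%N) = 0 by exact: vfk.
have vu : form v (f 1%N) = 0 by exact: vfk.
have vx : form v (f 2%N) = 0 by exact: vfk.
have iso y : form (f 0%N + - f 2%N) y = 0 -> form (v + f 1%N) y = 0 ->
  form y y <= 0 by exact: frame_isotropic m1 vf y.
have iso' y : form (f 0%N + - - f 2%N) y = 0 -> form (v + - f 1%N) y = 0 ->
  form y y <= 0.
  exact: (frame_isotropic m1 (frame_opp vf)).
have J1E' : J1 = wedge (- f 2%N) (f 0%N) by rewrite J1E wedgeNl -wedgeC.
have P1 := @closed_orbitsP R m v (f 0%N) (f 1%N) (- f 2%N).
have P2 := @closed_orbitsP R m v (f 0%N) (- f 1%N) (- - f 2%N).
rewrite -J1E' -J2E in P1.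
rewrite wedgeNl (wedgeNl (f 1%N)) -J1E' -J2E span_pair_opp in P2.
have i1 : [/\ form v v = 1, form (f 0%N) (f 0%N) = 1,
    form (f 1%N) (f 1%N) = -1 & form (- f 2%N) (- f 2%N) = -1].
  by rewrite !formE opprK.
have i2 : [/\ form v v = 1, form (f 0%N) (f 0%N) = 1,
    form (- f 1%N) (- f 1%N) = -1 & form (- - f 2%N) (- - f 2%N) = -1].
  by rewrite !formE !opprK.
have o1 : [/\ form v (f 0%N) = 0, form v (f 1%N) = 0 & form v (- f 2%N) = 0] /\
    [/\ form (f 0%N) (f 1%N) = 0, form (f 0%N) (- f 2%N) = 0
    & form (f 1%N) (- f 2%N) = 0].
  by rewrite !formE vt vu vx tu tx ux oppr0.
have o2 : [/\ form v (f 0%N) = 0, form v (- f 1%N) = 0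
    & form v (- - f 2%N) = 0] /\
    [/\ form (f 0%N) (- f 1%N) = 0, form (f 0%N) (- - f 2%N) = 0
    & form (- f 1%N) (- - f 2%N) = 0].
  by rewrite !formE vt vu vx tu tx ux !oppr0.
split=> [[/(P1 i1 o1 iso)|/(P2 i2 o2 iso')] [g [Gg -> h]]|[g [Gg -> h]]].
- by exists g; split => //; left.
- by exists g; split => //; right.
by case: h => h; [left; apply/(P1 i1 o1 iso)|right; apply/(P2 i2 o2 iso')];
  exists g.
Qed.

Theorem mainTheorem6 (R : realType) (l : nat) (hl : (3 <= l)%N)
  (v : 'cV[R]_(2 + l.-1)) (hv : sqnorm v = 1)
  (sigma theta : 'M[R]_(2 + l.-1) -> 'M[R]_(2 + l.-1))
  (J1 J2 Xpp : 'M[R]_(2 + l.-1)) (X0p : nat -> 'M[R]_(2 + l.-1)) :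
  let G := @SO R 2 l.-1 in
  let H := stabilizer G v in
  let g := lie_algebra G in
  let h := lie_algebra H in
  let B := killing g in
  let qq := eigenspace_on g sigma (-1) in
  let p := eigenspace_on g theta (-1) in
  involutive_automorphism g sigma ->
  eigenspace_on g sigma 1 = h ->
  cartan_involution g theta ->
  (forall X, g X -> sigma (theta X) = theta (sigma X)) ->
  h J1 -> qq J2 ->
  free [:: J1; J2] ->
  maximal_abelian_in p <<[:: J1; J2]>>%VS ->
  (forall alpha beta : R, restricted_root g J1 J2 alpha beta <->
     (`|alpha| = 1 /\ `|beta| = 1) \/
     ((4 <= l)%N /\ ((`|alpha| = 1 /\ beta = 0) \/
                     (alpha = 0 /\ `|beta| = 1)))) ->
  root_space g J1 J2 1 1 Xpp ->
  bracket (theta Xpp) Xpp = 4%:R *: (J1 + J2) ->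
  is_basis (root_space g J1 J2 0 1) [seq X0p k | k <- iota 3 (l - 3)] ->
  (forall k : nat, (3 <= k < l)%N ->
     bracket (theta (X0p k)) (X0p k) = 2%:R *: J2) ->
  (forall j k : nat, (3 <= j < l)%N -> (3 <= k < l)%N -> j <> k ->
     B (X0p j) (theta (X0p k)) = 0) ->
  let AdS := homogeneous_space G H in
  let S := singularity G H theta J1 J2 in
  let q := qvec sigma theta J1 J2 Xpp X0p in
  let geodesic_from := @lightlike_geodesic R (2 + l.-1) l.-1 G H q in
  (exists2 x, AdS x &
     exists2 gamma, geodesic_from x gamma & escapes_future S gamma) /\
  (exists2 x, AdS x &
     forall gamma, geodesic_from x gamma -> intersects_future S gamma).
Proof.
(* With [l = m + 1], the hypothesis [3 <= l] is [1 < m] by conversion, and [k < l] is [k <= m]. *)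
case: l hl v hv sigma theta J1 J2 Xpp X0p => [//|m] m1 v v1 sigma theta J1 J2 Xpp
  X0p.
move=> G H g h B qq p; rewrite {}/B {}/qq {}/p {}/h {}/g {}/H {}/G.
rewrite -[m.+1.-1]/m lie_algebra_SO lie_algebra_stabilizer.
move=> sA sH [tA _] st J1h J2q J12f [[pa ab] _] _ Xr Xb [_ Xk] Xkb XkB.
have inJ1 : J1 \in <<[:: J1; J2]>>%VS by rewrite memv_span ?mem_head.
have inJ2 : J2 \in <<[:: J1; J2]>>%VS by rewrite memv_span ?inE ?eqxx ?orbT.
have J2n0 : J2 != 0 by apply: (free_not0 J12f); rewrite !inE eqxx orbT.
have Xkr k : (3 <= k <= m)%N ->
    root_space (@skew R 2 m) J1 J2 0 1 (X0p k).
  move=> /andP[k3 km]; apply/Xk/memv_span/map_f.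
  by rewrite mem_iota k3 subnKC.
have [vf qE J1E] := root_frame m1 v1 sA sH tA st J1h J2q (pa _ inJ1) (pa _ inJ2)
  (ab _ _ inJ1 inJ2) J2n0 Xr Xb Xkr Xkb XkB.
have thN := automorphism_nilpotent tA (pa _ inJ1) (pa _ inJ2).
have SE X := singularity_frame X m1 vf J1E (qE 1%N (ltnW m1)) thN.
split; first exact: (exists_escaping m1 vf qE SE).
exact: (exists_trapped m1 vf qE SE).
Qed.
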